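(* Let $m,n>-1/2$, $\alpha_1,\alpha_2>0$, let $X\sim\mathrm{VG}(m,\alpha_1,0,0)$ and $Y\sim\mathrm{VG}(n,\alpha_2,0,0)$ be independent and $Z=XY$. Then for all $t\in\mathbb{R}\setminus\{0\}$, \[ \varphi_Z(t)=\frac{\alpha_1\alpha_2}{2\sqrt\pi\,\Gamma(m+1/2)\Gamma(n+1/2)}|t|^{-1}G^{3,1}_{1,3}\bigg(\frac{\alpha_1^2\alpha_2^2}{4t^2}\,\bigg|\,{\frac12\atop 0,m,n}\bigg)=\frac{1}{\sqrt\pi\,\Gamma(m+1/2)\Gamma(n+1/2)}G^{3,1}_{1,3}\bigg(\frac{\alpha_1^2\alpha_2^2}{4t^2}\,\bigg|\,{1\atop \frac12,m+\frac12,n+\frac12}\bigg). \]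
   Context: For $\mu>-1/2$, $\alpha>0$ and $0\le|\beta|<\alpha$, $\mathrm{VG}(\mu,\alpha,\beta,0)$ denotes the variance-gamma distribution on $\mathbb{R}$ with probability density function $f(x)=\frac{(\alpha^2-\beta^2)^{\mu+1/2}}{\sqrt{\pi}(2\alpha)^{\mu}\Gamma(\mu+1/2)}e^{\beta x}|x|^{\mu}K_{\mu}(\alpha|x|)$, where $K_\nu$ is the modified Bessel function of the second kind. $\varphi_Z(t)=\mathbb{E}[e^{\mathrm{i}tZ}]$. The Meijer $G$-function is defined by $G^{k,l}_{p,q}\big(x\,\big|\,{a_1,\dots,a_p\atop b_1,\dots,b_q}\big)=\frac{1}{2\pi\mathrm{i}}\int_L\frac{\prod_{j=1}^k\Gamma(b_j-s)\prod_{j=1}^l\Gamma(1-a_j+s)}{\prod_{j=l+1}^p\Gamma(a_j-s)\prod_{j=k+1}^q\Gamma(1-b_j+s)}x^s\,\mathrm{d}s$, where the path $L$ separates the poles of the $\Gamma(b_j-s)$ from those of the $\Gamma(1-a_j+s)$, and empty products are $1$. *)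

(* Defs.v *)
From HB Require Import structures.
From mathcomp Require Import all_boot all_order all_algebra.
From mathcomp Require Import all_classical all_reals all_analysis.
From mathcomp Require Import complex.

Set Implicit Arguments.
Unset Strict Implicit.
Unset Printing Implicit Defensive.

Import Order.TTheory GRing.Theory Num.Theory.
Local Open Scope classical_set_scope.
Local Open Scope ring_scope.

Section Defs.
Variable R : realType.

Definition coshR (x : R) : R := (expR x + expR (- x)) / 2.

(** Real Gamma function (Euler integral), meaningful for x > 0. *)
Definition GammaR (x : R) : R :=
  \int[lebesgue_measure]_(u in [set u : R | 0 < u]) (u `^ (x - 1) * expR (- u)).

(** Modified Bessel function of the second kind, via the standard integral
    representation K_nu(x) = int_0^oo exp(-x cosh u) cosh(nu u) du (x > 0). *)
Definition BesselK (nu x : R) : R :=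
  \int[lebesgue_measure]_(u in [set u : R | 0 <= u])
     (expR (- (x * coshR u)) * coshR (nu * u)).

Definition vg_pdf (mu alpha beta : R) (x : R) : R :=
  (alpha ^+ 2 - beta ^+ 2) `^ (mu + 2^-1)
    / (Num.sqrt pi * (2 * alpha) `^ mu * GammaR (mu + 2^-1))
  * expR (beta * x) * `|x| `^ mu * BesselK mu (alpha * `|x|).

Definition cintegral (D : set R) (f : R -> R[i]) : R[i] :=
  Complex (\int[lebesgue_measure]_(x in D) complex.Re (f x))
          (\int[lebesgue_measure]_(x in D) complex.Im (f x)).

(** x ^ z for x > 0 real and z complex: exp(z ln x) *)
Definition cpowR (x : R) (z : R[i]) : R[i] :=
  Complex (x `^ (complex.Re z) * cos (complex.Im z * ln x))
          (x `^ (complex.Re z) * sin (complex.Im z * ln x)).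

(** Complex Gamma function by Euler's integral, valid for Re z > 0
    (the only arguments used below have positive real part). *)
Definition GammaC (z : R[i]) : R[i] :=
  cintegral [set u : R | 0 < u]
    (fun u => cpowR u (z - 1) * ((expR (- u))%:C)%C).

(** Meijer G-function G^{3,1}_{1,3}(x | a ; b1, b2, b3) for x > 0 and
    a - 1 < min(b1,b2,b3), defined by the contour integral over the vertical
    line L = { c + i y : y in R } with c = (a - 1 + min(b1,b2,b3)) / 2, which
    separates the poles of Gamma(b_j - s) (at s = b_j + k) from those of
    Gamma(1 - a + s) (at s = a - 1 - k).  Since ds = i dy,
    (1/(2 pi i)) int_L F(s) ds = (1/(2 pi)) int_R F(c + i y) dy. *)
Definition MeijerG31_13 (x a b1 b2 b3 : R) : R[i] :=
  let c := (a - 1 + Num.min b1 (Num.min b2 b3)) / 2 in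
  ((2 * pi)^-1)%:C%C *
  cintegral setT (fun y =>
    let s : R[i] := Complex c y in
    GammaC (b1%:C%C - s) * GammaC (b2%:C%C - s) * GammaC (b3%:C%C - s)
    * GammaC ((1 - a)%:C%C + s) * cpowR x s).

End Defs.

Section Prob.
Context {d : measure_display} {T : measurableType d} {R : realType}.

Definition has_pdf (P : probability T R) (X : T -> R) (f : R -> R) : Prop :=
  measurable_fun setT X /\
  forall A : set R, measurable A ->
    P (X @^-1` A) = (\int[lebesgue_measure]_(x in A) (f x)%:E)%E.

Definition indep2 (P : probability T R) (X Y : T -> R) : Prop :=
  forall A B : set R, measurable A -> measurable B ->
    P (X @^-1` A `&` Y @^-1` B) = (P (X @^-1` A) * P (Y @^-1` B))%E.

Definition charfun (P : probability T R) (Z : T -> R) (t : R) : R[i] :=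
  Complex (\int[P]_w cos (t * Z w)) (\int[P]_w sin (t * Z w)).

End Prob.

(* Main.v *)
Require Import Defs.
From HB Require Import structures.
From mathcomp Require Import all_boot all_order all_algebra.
From mathcomp Require Import all_classical all_reals all_analysis.
From mathcomp Require Import complex measurable_realfun ring lra.
Import Order.TTheory GRing.Theory Num.Theory.
Import numFieldNormedType.Exports.
Local Open Scope classical_set_scope.
Local Open Scope ring_scope.

Set Implicit Arguments.
Unset Strict Implicit.
Unset Printing Implicit Defensive.

(** Let [hexp k w = exp (k w - e^w)], so that
    [Gamma (k) = int_R hexp k w dw] after the substitution [u = e^w].

    The same kind of substitution in the integral for [K_m] exhibits
    [VG(m, alpha, 0, 0)] as a Gaussian law with Gamma distributed variance.
    Since [1 + cos] and [1 + sin] are nonnegative, Tonelli's theorem alone then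
    reduces [E[1 + cos (t X Y)]] and [E[1 + sin (t X Y)]] to Gaussian integrals,
    which leaves
    [int int hexp (m + 1/2) u hexp (n + 1/2) v (1 + e^(u + v) / x)^(-1/2) du dv].

    On the other side, [y |-> Gamma (c + i y)] is the Fourier transform of
    [hexp c], so Fourier inversion gives the Cahen-Mellin integral for
    [exp (- e^v)].  Each further factor [Gamma (b - s)] of the Mellin-Barnes
    integrand replaces the function [H] represented by the integral by
    [v |-> int hexp b w H (v + w) dw]; after three such steps the Meijer
    G-function has become the same double integral. *)

(** * Integration tools *)

(** A real-valued integral here is [fine] of an extended one, hence 0 when the latter is infinite.
    So every exchange of integrals is done either in the extended reals with nonnegative integrands
    or under an explicit product bound. The inversion step requires Gamma to be integrable along a
    vertical line; two integrations by parts bound it by a multiple of [1 / (1 + y^2)]. Three Gamma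
    factors produce a triple integral. It collapses to a double one because the exponent attached to
    [b1] is [b1 + 1 - a], which is [1/2] for both parameter sets of the theorem: the innermost
    integral is then a Gaussian integral in disguise, and it is the source of the inverse square
    root on the Meijer side. The contour abscissa [c] has to be carried along as a weight [e^(c v)],
    and cancels only at the end against [x^c]. *)

Ltac cont := cbv beta; lazymatch goal with
  | |- continuous _ => let z := fresh "z" in move=> z; cont
  | |- @prop_for _ _ _ _ => unfold prop_for; cont
  | |- continuous_at _ (fun _ => ?c) => exact: cst_continuous
  | |- continuous_at _ (fun x => x) => exact: cvg_id
  | |- continuous_at _ (fun x => @?f x + @?g x) => apply: (@continuousD _ _ _ f g); cont
  | |- continuous_at _ (fun x => - @?f x) => apply: (@continuousN _ _ _ f); cont
  | |- continuous_at _ (fun x => @?f x * @?g x) => apply: (@continuousM _ _ f g); cont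
  | |- continuous_at _ (fun x => @?f x ^+ 2) => apply: (@continuousM _ _ f f); cont
  | |- continuous_at _ (fun x => expR (@?f x)) => apply: (@continuous_comp _ _ _ f expR); [cont|exact: continuous_expR]
  | |- continuous_at _ (fun x => cos (@?f x)) => apply: (@continuous_comp _ _ _ f cos); [cont|exact: continuous_cos]
  | |- continuous_at _ (fun x => sin (@?f x)) => apply: (@continuous_comp _ _ _ f sin); [cont|exact: continuous_sin]
  | |- continuous_at _ (fun x => `| @?f x |) => apply: (@continuous_comp _ _ _ f Num.norm); [cont|exact: norm_continuous]
  | |- continuous_at _ (fun x => ?g (@?f x)) => apply: (@continuous_comp _ _ _ f g); [cont|try match goal with H : continuous g |- _ => exact: H end]
  | |- _ => try done
  end.

Section measurable_comp.
Context {R : realType} d {T : measurableType d}.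
Implicit Types (D : set T) (f : T -> R) (g : R -> R).

Lemma measurable_comp_continuous D f g :
  continuous g -> measurable_fun D f -> measurable_fun D (fun x => g (f x)).
Proof.
by move=> cg mf; apply: measurableT_comp mf; exact: continuous_measurable_fun.
Qed.

Lemma measurable_fun_expR D f :
  measurable_fun D f -> measurable_fun D (fun x => expR (f x)).
Proof. exact/measurable_comp_continuous/continuous_expR. Qed.

Lemma measurable_fun_cos D f :
  measurable_fun D f -> measurable_fun D (fun x => cos (f x)).
Proof. exact/measurable_comp_continuous/continuous_cos. Qed.

Lemma measurable_fun_sin D f :
  measurable_fun D f -> measurable_fun D (fun x => sin (f x)).
Proof. exact/measurable_comp_continuous/continuous_sin. Qed.

Lemma measurable_fun_opp D f :
  measurable_fun D f -> measurable_fun D (fun x => - f x).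
Proof. exact/measurable_comp_continuous/opp_continuous. Qed.

Lemma measurable_fun_norm D f :
  measurable_fun D f -> measurable_fun D (fun x => `|f x|).
Proof. exact/measurable_comp_continuous/norm_continuous. Qed.

End measurable_comp.

Ltac meas := cbv beta; lazymatch goal with
  | |- measurable_fun _ (fun _ => ?c) => exact: measurable_cst
  | |- measurable_fun _ (fun x => x) => exact: measurable_id
  | |- measurable_fun _ (fun x => fst x) => exact: measurable_fst
  | |- measurable_fun _ (fun x => snd x) => exact: measurable_snd
  | |- measurable_fun _ (fun x => (@?f x)%:E) => apply/measurable_EFinP; rewrite /comp; meas
  | |- measurable_fun _ (fun x => @?f x + @?g x) => apply: (@measurable_funD _ _ _ _ f g); meas
  | |- measurable_fun _ (fun x => - @?f x) => apply: (@measurable_fun_opp _ _ _ _ f); meas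
  | |- measurable_fun _ (fun x => @?f x * @?g x) => apply: (@measurable_funM _ _ _ _ f g); meas
  | |- measurable_fun _ (fun x => @?f x ^+ ?n) => apply: (@measurable_funX _ _ _ _ f n); meas
  | |- measurable_fun _ (fun x => expR (@?f x)) => apply: (@measurable_fun_expR _ _ _ _ f); meas
  | |- measurable_fun _ (fun x => cos (@?f x)) => apply: (@measurable_fun_cos _ _ _ _ f); meas
  | |- measurable_fun _ (fun x => sin (@?f x)) => apply: (@measurable_fun_sin _ _ _ _ f); meas
  | |- measurable_fun _ (fun x => `| @?f x |) => apply: (@measurable_fun_norm _ _ _ _ f); meas
  | |- measurable_fun _ (fun x => ?g (@?f x)) =>
     first [done
     | apply: (@measurableT_comp _ _ _ _ _ _ g _ f); [try done; try (by apply/measurable_EFinP)|meas]]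
  | |- _ => try done
  end.

Section tools.
Variable R : realType.
Notation mu := (@lebesgue_measure R).

Lemma measurable_continuous (D : set R) (f : R -> R) :
  continuous f -> measurable_fun D f.
Proof. by move=> cf; apply: measurable_funTS; exact: continuous_measurable_fun. Qed.

(** Substitution holds on each segment [[-n, n]]; by the intermediate value theorem the image
    segments exhaust [range F], and monotone convergence applies on both sides. Nonnegativity allows
    both sides to be infinite. *)
Lemma ge0_integral_substitution (F f G : R -> R) :
  (forall x : R, is_derive x 1 F (f x)) -> continuous f ->
  {homo F : x y / x < y} ->
  (forall x, 0 <= f x) ->
  (forall x, {for F x, continuous G}) -> (forall x, 0 <= G (F x)) ->
  (\int[mu]_(x in range F) (G x)%:E = \int[mu]_x (G (F x) * f x)%:E)%E.
Proof.
move=> dF cf ndF f0 cG G0.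
have cF : continuous F.
  by move=> x; apply/differentiable_continuous/derivable1_diffP; exact: ex_derive.
have F'E : derive1 F = f by apply/funext => x; rewrite derive1E; exact: derive_val.
have leF : {homo F : x y / x <= y}.
  by move=> x y; rewrite le_eqVlt => /predU1P[->//|/ndF/ltW].
pose I n : set R := `[- n%:R, n%:R]%classic; pose J n : set R := `[F (- n%:R), F n%:R]%classic.
have JE : range F = \bigcup_n J n.
  apply/seteqP; split => [_ [x _ <-]|y [n _]].
    have [n xn] : exists n : nat, `|x| <= n%:R.
      by exists (Num.truncn `|x|).+1; apply/ltW; rewrite truncnS_gt.
    exists n => //; rewrite /J/= in_itv/=.
    by move: xn; rewrite ler_norml => /andP[? ?]; rewrite !leF.
  rewrite /J/= in_itv/= => /andP[Fny yFn].
  have nn : (- n%:R : R) <= n%:R by rewrite (le_trans _ (ler0n _ _))// oppr_le0.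
  have [||x _ <-] := @IVT R F (- n%:R) n%:R y nn; last by exists x.
    exact: continuous_subspaceT.
  by rewrite min_l ?max_r ?leF// Fny.
have IE : setT = \bigcup_n I n.
  apply/seteqP; split => // x _.
  exists (Num.truncn `|x|).+1 => //.
  by rewrite /I/= in_itv/= -ler_norml ltW// truncnS_gt.
have rF n y : J n y -> exists x, y = F x.
  move=> Jny; have : range F y by rewrite JE; exists n.
  by move=> [x _ <-]; exists x.
have cGJ n : {within J n, continuous G}.
  by apply: continuous_in_subspaceT => y /[!inE] /rF[x ->]; exact: cG.
have eqIJ n : (\int[mu]_(x in J n) (G x)%:E = \int[mu]_(x in I n) (G (F x) * f x)%:E)%E.
  rewrite /J (@integration_by_substitution_increasing R F G (- n%:R) n%:R)//.
  - by rewrite F'E.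
  - by rewrite (le_trans _ (ler0n _ _))// oppr_le0.
  - by move=> x y _ _; exact: ndF.
  - by rewrite F'E => x _; exact: cf.
  - by rewrite F'E; apply: cvgP; apply: cvg_at_right_filter; exact: cf.
  - by rewrite F'E; apply: cvgP; apply: cvg_at_left_filter; exact: cf.
  - split; first by move=> x _; exact: ex_derive.
    + by apply: cvg_at_right_filter; exact: cF.
    + by apply: cvg_at_left_filter; exact: cF.
  - exact: (cGJ n).
transitivity (integral mu (\bigcup_n J n) (EFin \o G)).
  by congr (integral _ _ _); exact: JE.
have mI : measurable_fun setT (fun x => G (F x) * f x).
  apply: continuous_measurable_fun => x; apply: continuousM; last exact: cf.
  by apply: continuous_comp; [exact: cF|exact: cG].
have ndJ : nondecreasing_seq J.
  move=> n k nk; rewrite subsetEset; apply: subset_itv; rewrite bnd_simp leF//.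
    by rewrite lerN2 ler_nat.
  by rewrite ler_nat.
have ndI : nondecreasing_seq I.
  by move=> n k nk; rewrite subsetEset; apply: subset_itv; rewrite bnd_simp ?lerN2 ler_nat.
have := @ge0_nondecreasing_set_cvg_integral _ (measurableTypeR R) R J (EFin \o G) mu ndJ.
move=> /(_ _ _ _)/cvg_lim <-//; last 3 first.
- by move=> n; exact: measurable_itv.
- move=> n; apply/measurable_EFinP; apply: subspace_continuous_measurable_fun => //.
  exact: measurable_itv.
- by move=> n y /rF[x ->] /=; rewrite lee_fin.
have := @ge0_nondecreasing_set_cvg_integral _ (measurableTypeR R) R I (fun x => (G (F x) * f x)%:E) mu ndI.
rewrite {1}[in RHS]IE => /(_ _ _ _)/cvg_lim <-//; last 3 first.
- by move=> n; exact: measurable_itv.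
- by move=> n; apply/measurable_EFinP; exact: measurable_funTS.
- by move=> n y _; rewrite lee_fin mulr_ge0.
by congr (limn _); apply/funext => n; rewrite eqIJ.
Qed.

Lemma ge0_integralT_expR (G : R -> R) :
  (forall x : R, 0 < x -> {for x, continuous G}) ->
  (forall x : R, 0 < x -> 0 <= G x) ->
  (\int[mu]_(x in [set x | 0 < x]%R) (G x)%:E = \int[mu]_x (G (expR x) * expR x)%:E)%E.
Proof.
move=> cG G0; rewrite -(@ge0_integral_substitution expR expR G)//.
- congr (integral _ _ _); apply/seteqP; split => [x x0|_ [x _ <-]] /=.
    by exists (ln x) => //; rewrite lnK.
  exact: expR_gt0.
- exact: continuous_expR.
- by move=> x y; rewrite ltr_expR.
- by move=> x; apply: cG; exact: expR_gt0.
- by move=> x; apply: G0; exact: expR_gt0.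
Qed.

Lemma ge0_integralT_affine (a b : R) (G : R -> R) : 0 < a -> continuous G -> (forall x, 0 <= G x) ->
  (\int[mu]_x (G x)%:E = a%:E * \int[mu]_x (G (a * x + b))%:E)%E.
Proof.
move=> a0 cG G0.
pose F x := a * x + b.
have -> : (\int[mu]_x (G x)%:E = \int[mu]_(x in range F) (G x)%:E)%E.
  congr (integral _ _ _); apply/seteqP; split => // x _ /=.
  exists ((x - b) / a) => //; rewrite /F.
  by rewrite mulrC divfK ?gt_eqF// subrK.
have dF (x : R) : is_derive x 1 F (cst a x).
  by rewrite /F; apply: is_derive_eq; rewrite addr0; exact: mulr1.
rewrite (@ge0_integral_substitution F (cst a) G dF)//.
- rewrite -ge0_integralZl//.
  + by apply: eq_integral => x _; rewrite mulrC EFinM.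
  + have mG : measurable_fun [set: R] G by exact: continuous_measurable_fun.
    meas.
  + by move=> x _; rewrite lee_fin.
  + by rewrite lee_fin ltW.
- exact: cst_continuous.
- by move=> x y xy; rewrite /F ltrD2r ltr_pM2l.
- by move=> x; exact: ltW.
- by move=> x; exact: cG.
Qed.

(** Folding doubles even integrands, cancels odd parts, and turns [e^(nu u)] into a hyperbolic
    cosine. *)
Lemma ge0_integralT_fold (G : R -> R) : continuous G -> (forall x, 0 <= G x) ->
  (\int[mu]_x (G x)%:E = \int[mu]_(x in [set x | 0 <= x]%R) (G x + G (- x))%:E)%E.
Proof.
move=> cG G0.
have mG : measurable_fun [set: R] G by exact: continuous_measurable_fun.
have mGN : measurable_fun [set: R] (fun x => G (- x)).
  by apply: measurableT_comp => //; exact: oppr_measurable.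
have mposnums : measurable [set x : R | 0 <= x]%R by rewrite -set_itvcy.
rewrite -(setUv [set x : R | 0 <= x]%R) ge0_integral_setU//= ; last 4 first.
  exact: measurableC.
  by apply/measurable_EFinP; rewrite setUv.
  by move=> x _; rewrite lee_fin.
  exact/disj_setPCl.
under [in RHS]eq_integral do rewrite EFinD.
rewrite ge0_integralD//; last 4 first.
  by move=> x _; rewrite lee_fin.
  by apply/measurable_EFinP/measurable_funTS.
  by move=> x _; rewrite lee_fin.
  by apply/measurable_EFinP/measurable_funTS.
congr +%E.
rewrite -set_itvcy// setCitvr.
rewrite integral_itv_bndo_bndc; last exact/measurable_EFinP/measurable_funTS.
rewrite -{1}oppr0 ge0_integration_by_substitutionNy//.
exact: continuous_subspaceT.
Qed.

End tools.

(** * Functions of quadratic decay *)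

Section decay.
Variable R : realType.
Notation mu := (@lebesgue_measure R).
Implicit Types f g : R -> R.

(** The common integrability criterion: stable under sums and bounded factors, strong enough to make
    boundary terms vanish, and exactly what two integrations by parts give for a Fourier
    transform. *)
Definition quad_decay f := exists C, forall x, `|f x| * (1 + x ^+ 2) <= C.

Let pos (x : R) : 0 < 1 + x ^+ 2.
Proof. by rewrite ltr_pwDl// sqr_ge0. Qed.

Lemma integrable_oneDsqrV : mu.-integrable setT (fun x => ((1 + x ^+ 2)^-1)%:E).
Proof.
have cV : continuous (fun x : R => (1 + x ^+ 2)^-1) by exact: continuous_oneDsqrV.
apply/integrableP; split.
  by apply/measurable_EFinP; exact: continuous_measurable_fun.
under eq_integral do rewrite gee0_abs ?lee_fin ?invr_ge0 ?(ltW (pos _))//.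
rewrite ge0_integralT_fold//; last by move=> x; rewrite invr_ge0 ltW.
under eq_integral do rewrite sqrrN -mulr2n -mulr_natl EFinM.
rewrite -set_itvcy.
rewrite ge0_integralZl//.
- by rewrite integral0y_oneDsqr -EFinM ltry.
  by apply/measurable_EFinP; apply: measurable_funTS; exact: continuous_measurable_fun.
- by move=> x _; rewrite lee_fin invr_ge0 ltW.
Qed.

Lemma integrable_quad_decay f : measurable_fun setT f -> quad_decay f ->
  mu.-integrable setT (EFin \o f).
Proof.
move=> mf [C fC].
apply: (@le_integrable _ _ _ mu setT measurableT _ (fun x => C%:E * ((1 + x ^+ 2)^-1)%:E)%E).
- exact/measurable_EFinP.
- move=> x _ /=; rewrite lee_fin normrM (ger0_norm (x := (_)^-1)) ?invr_ge0 ?(ltW (pos _))//.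
  rewrite ler_pdivlMr//; apply: le_trans (ler_norm _); exact: fC.
- exact: integrableZl integrable_oneDsqrV.
Qed.

Lemma quad_decayD f g : quad_decay f -> quad_decay g -> quad_decay (fun x => f x + g x).
Proof.
move=> [C fC] [D gD]; exists (C + D) => x; apply: le_trans (lerD (fC x) (gD x)).
by rewrite -mulrDl ler_wpM2r ?(ltW (pos _))// ler_normD.
Qed.

Lemma quad_decayM f g M : (forall x, `|f x| <= M) -> quad_decay g ->
  quad_decay (fun x => f x * g x).
Proof.
move=> fM [C gC]; exists (M * C) => x; rewrite normrM -mulrA.
by apply: ler_pM => //; rewrite mulr_ge0// ltW.
Qed.

Lemma quad_decayZ f (a : R) : quad_decay f -> quad_decay (fun x => a * f x).
Proof. exact: (@quad_decayM (cst a) f `|a|). Qed.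

Lemma quad_decay_cos f (a : R) : quad_decay f -> quad_decay (fun x => cos (a * x) * f x).
Proof. by apply: (@quad_decayM _ f 1) => x; rewrite ler_norml cos_geN1 cos_le1. Qed.

Lemma quad_decay_sin f (a : R) : quad_decay f -> quad_decay (fun x => sin (a * x) * f x).
Proof. by apply: (@quad_decayM _ f 1) => x; rewrite ler_norml sin_geN1 sin_le1. Qed.

Lemma quad_decay_bounded f : quad_decay f -> exists C, forall x, `|f x| <= C.
Proof.
move=> [C fC]; exists C => x; apply: le_trans (fC x).
by rewrite ler_peMr// lerDl sqr_ge0.
Qed.

Lemma quad_decay_eq f g : f =1 g -> quad_decay f -> quad_decay g.
Proof. by move=> /funext ->. Qed.

(** Square of [1 + x / 2 <= e^(x / 2)]. *)
Lemma expR_ge_sqr (x : R) : 0 <= x -> x ^+ 2 / 4 <= expR x.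
Proof.
move=> x0; have := expR_ge1Dx (x / 2).
have -> : expR x = expR (x / 2) ^+ 2 by rewrite -expRM_natl; congr expR; lra.
move: (expR (x / 2)) => y; nra.
Qed.

Lemma quad_decay_expR f (A d : R) : 0 < d -> (forall x, f x <= A - d * `|x|) ->
  quad_decay (fun x => expR (f x)).
Proof.
(* The summands [1] and [4 / d^2] come from [1 <= e^(d |x|)] and [x^2 <= (4 / d^2) e^(d |x|)]. *)
move=> d0 fA; exists (expR A * (1 + 4 / d ^+ 2)) => x.
rewrite ger0_norm ?expR_ge0//.
apply: (@le_trans _ _ (expR (A - d * `|x|) * (1 + x ^+ 2))).
  by rewrite ler_wpM2r ?(ltW (pos _))// ler_expR.
rewrite expRD -mulrA ler_wpM2l ?expR_ge0// expRN mulrC ler_pdivrMr ?expR_gt0//.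
have t0 : 0 <= d * `|x| by rewrite mulr_ge0// ltW.
have e1 : 1 <= expR (d * `|x|) by rewrite -expR0 ler_expR.
have /expR_ge_sqr := t0; rewrite exprMn real_normK ?num_real// => e2.
rewrite mulrDl mul1r lerD// mulrAC ler_pdivlMr ?exprn_gt0//.
by move: e2; lra.
Qed.

(** With [e^w] replaced by [w^2 / 4], completing the square bounds [(k + 1) w - c w^2 / 4] by
    [(k + 1)^2 / c]; using [k + 1] in place of [k] gains the term [- w]. *)
Lemma expR_quad_bound (k c w : R) : 0 < c -> 0 <= w ->
  k * w - c * expR w <= (k + 1) ^+ 2 / c - w.
Proof.
move=> c0 w0; have e := expR_ge_sqr w0.
have : c * (w ^+ 2 / 4) <= c * expR w by rewrite ler_wpM2l// ltW.
have : 0 <= (k + 1 - c * w / 2) ^+ 2 / c by rewrite divr_ge0 ?sqr_ge0// ltW.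
have -> : (k + 1 - c * w / 2) ^+ 2 / c = (k + 1) ^+ 2 / c - (k + 1) * w + c * (w ^+ 2 / 4).
  by field; rewrite gt_eqF.
lra.
Qed.

Definition hexp (k w : R) := expR (k * w - expR w).

Lemma hexp_ge0 k w : 0 <= hexp k w. Proof. exact: expR_ge0. Qed.

Lemma continuous_hexp k : continuous (hexp k).
Proof. rewrite /hexp; cont. Qed.

Lemma measurable_hexp k : measurable_fun setT (hexp k).
Proof. by apply: measurable_continuous; exact: continuous_hexp. Qed.

Lemma hexpD k l w : hexp (k + l) w = expR (l * w) * hexp k w.
Proof. by rewrite /hexp -expRD; congr expR; ring. Qed.

(** The left tail decays at rate [k] because of [e^(k w)], the right tail at rate 1 because of the
    double exponential. *)
Lemma quad_decay_expR_expR (k c : R) : 0 < k -> 0 < c ->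
  quad_decay (fun w => expR (k * w - c * expR w)).
Proof.
move=> k0 c0; apply: (@quad_decay_expR _ ((k + 1) ^+ 2 / c) (Num.min k 1)).
  by rewrite lt_min k0 ltr01.
move=> w; have A0 : 0 <= (k + 1) ^+ 2 / c by rewrite divr_ge0 ?sqr_ge0// ltW.
have [w0|w0] := lerP 0 w.
  rewrite ger0_norm//; apply: le_trans (expR_quad_bound _ c0 w0) _.
  by rewrite lerD2l lerN2 ler_piMl// ge_min lexx orbT.
rewrite ltr0_norm// mulrN opprK.
have mk : Num.min k 1 <= k by rewrite ge_min lexx.
have : k * w <= Num.min k 1 * w by move: (Num.min k 1) mk => m mk; nra.
by have := mulr_ge0 (ltW c0) (expR_ge0 w); lra.
Qed.

Lemma quad_decay_hexp k : 0 < k -> quad_decay (hexp k).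
Proof.
move=> k0; apply: quad_decay_eq (quad_decay_expR_expR k0 ltr01) => w.
by rewrite mul1r.
Qed.

Lemma integrable_hexp k : 0 < k -> mu.-integrable setT (EFin \o hexp k).
Proof.
by move=> k0; apply: integrable_quad_decay; [exact: measurable_hexp|exact: quad_decay_hexp].
Qed.

Lemma quad_decay_gauss (l : R) : 0 < l -> quad_decay (fun x => expR (- (l * x ^+ 2))).
Proof.
move=> l0; exists (1 + l^-1) => x; rewrite ger0_norm ?expR_ge0//.
rewrite expRN mulrC ler_pdivrMr ?expR_gt0//.
have := expR_ge1Dx (l * x ^+ 2).
have p : 0 <= l * x ^+ 2 by rewrite mulr_ge0 ?sqr_ge0// ltW.
move=> e; apply: (@le_trans _ _ ((1 + l^-1) * (1 + l * x ^+ 2))).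
  have -> : (1 + l^-1) * (1 + l * x ^+ 2) = 1 + x ^+ 2 + (l^-1 + l * x ^+ 2) by field; rewrite gt_eqF.
  by rewrite lerDl addr_ge0// invr_ge0 ltW.
by rewrite ler_wpM2l// addr_ge0// invr_ge0 ltW.
Qed.

(** The Gaussian is the square of one of rate [l / 2]: one copy absorbs [1 + x^2], the other absorbs
    [|x| <= 1 + x^2]. *)
Lemma quad_decay_Mgauss (l : R) : 0 < l -> quad_decay (fun x => x * expR (- (l * x ^+ 2))).
Proof.
move=> l0; have l2 : 0 < l / 2 by rewrite divr_gt0.
have [C gC] := quad_decay_gauss l2.
exists (C ^+ 2) => x; have := gC x.
rewrite normrM !(ger0_norm (expR_ge0 _)).
have -> : expR (- (l * x ^+ 2)) = expR (- (l / 2 * x ^+ 2)) ^+ 2.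
  by rewrite -expRM_natl; congr expR; field.
move: (expR_ge0 (- (l / 2 * x ^+ 2))); move: (expR _) => y y0 yC.
apply: (@le_trans _ _ ((y * (1 + x ^+ 2)) ^+ 2)); last first.
  by rewrite lerXn2r ?nnegrE ?mulr_ge0 ?(ltW (pos _))// (le_trans _ yC)// mulr_ge0// ltW.
have xx : `|x| <= 1 + x ^+ 2.
  have := real_normK (num_real x); have := normr_ge0 x; move: `|x| => z; nra.
have -> : (y * (1 + x ^+ 2)) ^+ 2 = (1 + x ^+ 2) * (y ^+ 2 * (1 + x ^+ 2)) by ring.
rewrite -[X in X <= _]mulrA.
by apply: ler_wpM2r xx; rewrite mulr_ge0 ?sqr_ge0// ltW.
Qed.

Lemma quad_decay_cvg0 f (u : nat -> R) : quad_decay f ->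
  (forall n, `|u n| = n%:R) -> f (u n) @[n --> \oo] --> 0.
Proof.
move=> [C fC] un; apply: norm_cvg0.
apply: (@squeeze_cvgr _ _ _ _ (cst 0) (fun n => `|C| * n.+1%:R^-1)).
- apply: nearW => n; rewrite normr_ge0/= ler_pdivlMr ?ltr0n//.
  apply: le_trans (le_trans (fC (u n)) (ler_norm C)).
  rewrite ler_wpM2l// -natr1 addrC lerD2l -real_normK ?num_real// un -natrX ler_nat.
  by case: n => // n; rewrite expnS leq_pmulr.
- exact: cvg_cst.
- rewrite -[X in _ --> X](mulr0 `|C|); apply: cvgMr.
  exact: cvg_harmonic.
Qed.

Lemma Rintegral_cvg_segments f : mu.-integrable setT (EFin \o f) ->
  \int[mu]_(x in `[- n%:R, n%:R]) f x @[n --> \oo] --> \int[mu]_x f x.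
Proof.
move=> fi; have mf : measurable_fun setT f by apply/measurable_EFinP; exact: measurable_int fi.
pose I n : set R := `[- n%:R, n%:R]%classic.
have mI n : measurable (I n) by exact: measurable_itv.
have [] := @dominated_convergence _ _ R mu setT measurableT
  (fun n => (EFin \o f) \_ (I n)) (EFin \o f) (abse \o (EFin \o f)).
- move=> n; apply/(measurable_restrictT (EFin \o f)) => //.
  by apply/measurable_EFinP; exact: measurable_funTS.
- exact/measurable_EFinP.
- apply: aeW => x _; apply: cvg_near_cst.
  exists (Num.truncn `|x|).+1 => // n /= xn.
  rewrite patchE mem_set// /I/= in_itv/= -ler_norml.
  by rewrite (le_trans _ (_ : (Num.truncn `|x|).+1%:R <= _)) ?ler_nat// ltW// truncnS_gt.
- exact: integrable_abse.
- by apply: aeW => x n _; rewrite /= patchE; case: ifP => // _; rewrite abse0.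
move=> _ _ h; rewrite /Rintegral; apply: fine_cvg.
rewrite fineK; last exact: integrable_fin_num.
under eq_fun do rewrite integral_mkcond.
exact: h.
Qed.

(** Every integration by parts below has this form, with [F] the whole boundary term: the integral
    over [[-n, n]] is [F n - F (- n)], which tends to 0. *)
Lemma Rintegral_derive_eq0 (F f : R -> R) :
  (forall x : R, is_derive x 1 F (f x)) -> continuous f ->
  mu.-integrable setT (EFin \o f) -> quad_decay F -> \int[mu]_x f x = 0.
Proof.
move=> dF cf fi qF; have /cvg_lim <- // := Rintegral_cvg_segments fi.
have cF : continuous F.
  by move=> x; apply/differentiable_continuous/derivable1_diffP; exact: ex_derive.
have E : \forall n \near \oo, F n%:R - F (- n%:R) = \int[mu]_(x in `[- n%:R, n%:R]) f x.
  exists 1 => // n /= n1; rewrite /Rintegral (@continuous_FTC2 _ f F)//.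
  - by rewrite (@lt_trans _ _ 0)// ?oppr_lt0 ltr0n.
  - exact: continuous_subspaceT.
  - split; first by move=> x _; exact: ex_derive.
    + by apply: cvg_at_right_filter; exact: cF.
    + by apply: cvg_at_left_filter; exact: cF.
  - by move=> x _; rewrite derive1E; exact: derive_val.
have h : F n%:R - F (- n%:R) @[n --> \oo] --> 0.
  rewrite -[X in _ --> X](subr0 0); apply: cvgB.
    by apply: (@quad_decay_cvg0 _ (fun n => n%:R)) => // n; rewrite ger0_norm.
  by apply: (@quad_decay_cvg0 _ (fun n => - n%:R)) => // n; rewrite normrN ger0_norm.
by apply: cvg_lim => //; apply: cvg_trans h; apply: near_eq_cvg; apply: filterS E => n ->.
Qed.

End decay.

(** * Gaussian integrals and Fourier inversion *)

Section Rintegral_tools.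
Variable R : realType.
Notation mu := (@lebesgue_measure R).

(** Writing [f = (|f| + f) - |f|] reduces to two nonnegative continuous functions; the absolute
    value keeps continuity available. *)
Lemma Rintegral_affine (a b : R) (f : R -> R) : 0 < a -> continuous f ->
  mu.-integrable setT (EFin \o f) ->
  \int[mu]_x f x = a * \int[mu]_x f (a * x + b).
Proof.
move=> a0 cf fi.
have sub (g : R -> R) : continuous g -> (forall x, 0 <= g x) -> mu.-integrable setT (EFin \o g) ->
    mu.-integrable setT (fun x => (g (a * x + b))%:E) /\
    \int[mu]_x g x = a * \int[mu]_x g (a * x + b).
  move=> cg g0 gi; have := ge0_integralT_affine b a0 cg g0.
  have cgab : continuous (fun x => g (a * x + b)) by cont.
  have [F|] := boolP ((\int[mu]_x (g (a * x + b))%:E)%E \is a fin_num).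
    move=> e; split; last by rewrite /Rintegral e fineM.
    apply/integrableP; split.
      by apply/measurable_EFinP; exact: measurable_continuous.
    under eq_integral do rewrite gee0_abs ?lee_fin//.
    by rewrite ltey_eq F.
  (* Were the substituted integral infinite, the identity in the extended reals would make the
     integral of [g] infinite as well. *)
  rewrite ge0_fin_numE; last by apply: integral_ge0 => x _; rewrite lee_fin.
  rewrite -leNgt leye_eq => /eqP ->; rewrite gt0_muley ?lte_fin// => e.
  by have := integrable_fin_num measurableT gi; rewrite e.
have cn : continuous (fun x => `|f x|) by cont.
have fn : mu.-integrable setT (fun x => (`|f x|)%:E) by exact: (integrable_norm fi).
have nf : mu.-integrable setT (EFin \o (fun x => `|f x| + f x)).
  by have := integrableD measurableT fn fi.
have [i1 e1] := sub _ cn (fun x => normr_ge0 _) fn.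
have [||i2 e2] := sub (fun x => `|f x| + f x) _ _ nf.
- by cont.
- by move=> x; rewrite -lerBlDr sub0r -normrN ler_norm.
have -> : \int[mu]_x f x = \int[mu]_x (`|f x| + f x) - \int[mu]_x `|f x|.
  by rewrite -RintegralB//; apply: eq_Rintegral => x _; rewrite addrAC subrr add0r.
have -> : \int[mu]_x f (a * x + b) =
    \int[mu]_x (`|f (a * x + b)| + f (a * x + b)) - \int[mu]_x `|f (a * x + b)|.
  by rewrite -RintegralB//; apply: eq_Rintegral => x _; rewrite addrAC subrr add0r.
by rewrite mulrBr e1 e2.
Qed.

End Rintegral_tools.

Section Rintegral_Fubini.
Context {R : realType} {d1 d2 : measure_display}.
Context {T1 : measurableType d1} {T2 : measurableType d2}.
Variables (m1 : {sigma_finite_measure set T1 -> \bar R})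
  (m2 : {sigma_finite_measure set T2 -> \bar R}).
Variables (k : T1 -> T2 -> R) (f : T1 -> R) (g : T2 -> R).
Hypotheses (mk : measurable_fun setT (fun z : T1 * T2 => k z.1 z.2))
  (fi : m1.-integrable setT (EFin \o f)) (gi : m2.-integrable setT (EFin \o g))
  (kfg : forall x y, `|k x y| <= f x * g y).

Let kE := fun z : T1 * T2 => (k z.1 z.2)%:E.

Let integrable_k : (m1 \x m2)%E.-integrable setT kE.
Proof.
have mkE : measurable_fun setT kE by exact/measurable_EFinP.
apply/(integrable12ltyP _ _ mkE).
apply: (@le_lt_trans _ _ (\int[m1]_x ((\int[m2]_y `|g y|%:E) * `|f x|%:E))%E).
  apply: ge0_le_integral => //.
  - by move=> x _; apply: integral_ge0.
  - apply: (measurable_fun_fubini_tonelli_F (abse \o kE)) => //.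
    + exact: measurableT_comp.
    + by move=> z /=.
  - apply: (@emeasurable_funM _ _ _ _ (cst _) (fun x => `|(f x)%:E|%E)) => //.
    by apply: measurableT_comp => //; exact: measurable_int fi.
  - move=> x _; rewrite -ge0_integralZr//; last first.
      exact: measurable_int (integrable_norm gi).
    apply: ge0_le_integral => //.
    + by apply: measurableT_comp => //; exact: measurableT_comp mkE _.
    + apply: (@emeasurable_funM _ _ _ _ (fun y => `|(g y)%:E|%E) (cst _)) => //.
      exact: measurable_int (integrable_norm gi).
    + move=> y _; rewrite /kE /= -EFinM lee_fin mulrC.
      by apply: le_trans (kfg x y) _; rewrite -normrM ler_norm.
rewrite ge0_integralZl//; last 2 first.
- exact: measurable_int (integrable_norm fi).
- exact: integral_ge0.
case/integrableP : fi => _ fl; case/integrableP : gi => _ gl.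
by apply: lte_mul_pinfty => //; [exact: integral_ge0|rewrite ge0_fin_numE//; exact: integral_ge0].
Qed.

Let i1 x : m2.-integrable setT (fun y => (k x y)%:E).
Proof.
apply: (@le_integrable _ _ _ m2 setT measurableT _ (fun y => (f x)%:E * (g y)%:E)%E).
- by apply/measurable_EFinP; exact: (measurableT_comp (g := pair x) mk).
- by move=> y _ /=; rewrite lee_fin; apply: le_trans (kfg x y) (ler_norm _).
- exact: integrableZl.
Qed.

Let i2 y : m1.-integrable setT (fun x => (k x y)%:E).
Proof.
apply: (@le_integrable _ _ _ m1 setT measurableT _ (fun x => (g y)%:E * (f x)%:E)%E).
- by apply/measurable_EFinP; exact: (measurableT_comp (g := fun x => (x, y)) mk).
- by move=> x _ /=; rewrite lee_fin mulrC; apply: le_trans (kfg x y) (ler_norm _).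
- exact: integrableZl.
Qed.

Let E1 x : ((\int[m2]_y k x y)%:E = \int[m2]_y (k x y)%:E)%E.
Proof. rewrite fineK//; exact: integrable_fin_num (i1 x). Qed.

Let E2 y : ((\int[m1]_x k x y)%:E = \int[m1]_x (k x y)%:E)%E.
Proof. rewrite fineK//; exact: integrable_fin_num (i2 y). Qed.

(** The product bound makes every section integrable, not merely almost every one, so [fine] loses
    nothing in the inner integrals and the extended version of Fubini transfers. *)
Lemma Rintegral_Fubini :
  \int[m1]_x \int[m2]_y k x y = \int[m2]_y \int[m1]_x k x y.
Proof.
rewrite /Rintegral; congr fine.
under eq_integral do rewrite E1; under [RHS]eq_integral do rewrite E2.
exact: (Fubini integrable_k).
Qed.

Lemma integrable_Rintegral_l : m1.-integrable setT (EFin \o (fun x => \int[m2]_y k x y)).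
Proof.
by apply: eq_integrable (integrable_fubini_F integrable_k) => // x _; rewrite /= E1.
Qed.

End Rintegral_Fubini.

(** * Fourier transform of the Gaussian, and inversion at the origin *)

Section gauss_fourier.
Variable R : realType.
Notation mu := (@lebesgue_measure R).

Lemma continuous_gauss (l : R) : continuous (fun x : R => expR (- (l * x ^+ 2))).
Proof. cont. Qed.

Lemma integrable_gauss (l : R) : 0 < l ->
  mu.-integrable setT (fun x => (expR (- (l * x ^+ 2)))%:E).
Proof.
move=> l0; apply: integrable_quad_decay (quad_decay_gauss l0).
by apply: measurable_continuous; exact: continuous_gauss.
Qed.

Lemma Rintegral_gauss (l : R) : 0 < l ->
  \int[mu]_x expR (- (l * x ^+ 2)) = Num.sqrt (pi / l).
Proof.
move=> l0; have s0 : 0 < Num.sqrt l by rewrite sqrtr_gt0.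
have : \int[mu]_x gauss_fun x = Num.sqrt pi by rewrite /Rintegral integralT_gauss.
rewrite (Rintegral_affine 0 s0 (@continuous_gauss_fun R) (@integrableT_gauss R)).
rewrite sqrtrM ?pi_ge0// sqrtrV ?(ltW l0)// => <-.
rewrite mulrAC mulfV ?gt_eqF// mul1r; apply: eq_Rintegral => x _.
by rewrite /gauss_fun addr0 exprMn sqr_sqrtr// ltW.
Qed.

(* Cosine and sine are treated together.  The factor [b%:R] in the transforms
   below expresses that the sine transform of an even function vanishes. *)
Definition trig (b : bool) : R -> R := if b then cos else sin.

Lemma continuous_trig b : continuous (trig b).
Proof. by case: b; [exact: continuous_cos|exact: continuous_sin]. Qed.

Lemma trig_le1 b x : `|trig b x| <= 1.
Proof.
by case: b; rewrite ler_norml /= ?cos_geN1 ?cos_le1 ?sin_geN1 ?sin_le1.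
Qed.

Lemma trig_ge0 b x : 0 <= 1 + trig b x.
Proof. by have := trig_le1 b x; rewrite ler_norml => /andP[]; lra. Qed.

Let e (l x : R) := expR (- (l * x ^+ 2)).
Let G l s := \int[mu]_x (cos (s * x) * e l x).

Let me l : measurable_fun setT (e l).
Proof. by apply: measurable_continuous; exact: continuous_gauss. Qed.

Let intc l s : 0 < l -> mu.-integrable setT (EFin \o (fun x => cos (s * x) * e l x)).
Proof.
move=> l0; apply: integrable_quad_decay; last exact/quad_decay_cos/quad_decay_gauss.
by have mel := me l; meas.
Qed.

Let ints l s : 0 < l -> mu.-integrable setT (EFin \o (fun x => sin (s * x) * (x * e l x))).
Proof.
move=> l0; apply: integrable_quad_decay; last exact/quad_decay_sin/quad_decay_Mgauss.
by have mel := me l; meas.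
Qed.

Let by_parts l s : 0 < l -> 2 * l * \int[mu]_x (sin (s * x) * (x * e l x)) = s * G l s.
Proof.
move=> l0.
have := @Rintegral_derive_eq0 R (fun x => sin (s * x) * e l x)
  (fun x => s * (cos (s * x) * e l x) - 2 * l * (sin (s * x) * (x * e l x))) _ _ _ _.
rewrite RintegralB//; last 2 first.
- exact: (integrableZl measurableT s (intc s l0)).
- exact: (integrableZl measurableT (2 * l) (ints s l0)).
rewrite !RintegralZl//; last 2 first.
- exact: ints.
- exact: intc.
move=> h; apply/esym/subr0_eq; apply: h.
- move=> x; rewrite /e; apply: is_derive_eq.
  rewrite /GRing.scale/=; ring.
- by rewrite /e; cont.
- exact: (integrableB measurableT (integrableZl measurableT s (intc s l0))
    (integrableZl measurableT (2 * l) (ints s l0))).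
- exact/quad_decay_sin/quad_decay_gauss.
Qed.

Let derG (l s : R) : 0 < l -> is_derive s 1 (G l) (- (s / (2 * l)) * G l s).
Proof.
move=> l0.
pose f (s x : R) := cos (s * x) * e l x.
have df (x y : R) : is_derive x 1 (f ^~ y) (- (sin (x * y) * (y * e l y))).
  by rewrite /f; apply: is_derive_eq; rewrite /GRing.scale/=; ring.
have pf x y : partial1of2 f x y = - (sin (x * y) * (y * e l y)).
  by rewrite /partial1of2 derive1E; exact: derive_val.
have Is : `]s - 1, s + 1[%classic s by rewrite /= in_itv/=; apply/andP; split; lra.
have Gi : mu.-integrable setT (EFin \o (fun y => `|y * e l y|)).
  have H : mu.-integrable setT (EFin \o (fun y => y * e l y)).
    by apply: integrable_quad_decay (quad_decay_Mgauss l0); have mel := me l; meas.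
  exact: (integrable_norm H).
have bd x y : `]s - 1, s + 1[%classic x -> [set: R] y -> `|partial1of2 f x y| <= `|y * e l y|.
  move=> _ _; rewrite pf normrN normrM ler_piMl//.
  exact: (trig_le1 false).
have := @derivable_under_integral R _ _ mu f setT measurableT s (s - 1) (s + 1) Is
  (fun x _ => intc x l0) (fun x y _ _ => @ex_derive _ _ _ _ _ _ _ (df x y)) _ (fun y => normr_ge0 _) Gi bd.
have := @differentiation_under_integral R _ _ mu f setT measurableT s (s - 1) (s + 1) Is
  (fun x _ => intc x l0) (fun x y _ _ => @ex_derive _ _ _ _ _ _ _ (df x y)) _ (fun y => normr_ge0 _) Gi bd.
move=> dE dG; apply: DeriveDef => //.
rewrite -derive1E dE.
under eq_Rintegral do rewrite pf -mulN1r.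
rewrite RintegralZl//; last exact: ints.
have := by_parts s l0; move: (\int[mu]_x _) (G l s) => I J h.
have -> : I = s * J / (2 * l) by rewrite -h; field; rewrite gt_eqF.
by field; rewrite gt_eqF.
Qed.

(** Differentiation under the integral and one integration by parts give [G' = - s / (2 l) G], so
    [G] times [e^(s^2 / (4 l))] is constant. *)
Lemma Rintegral_gauss_cos (l s : R) : 0 < l ->
  \int[mu]_x (cos (s * x) * expR (- (l * x ^+ 2))) =
  Num.sqrt (pi / l) * expR (- (s ^+ 2 / (4 * l))).
Proof.
move=> l0.
have cst0 (x : R) : is_derive x 1 (fun s => G l s * expR (s ^+ 2 / (4 * l))) 0.
  have dG := derG x l0; apply: is_derive_eq.
  by rewrite /GRing.scale/=; field; rewrite gt_eqF.
have := @is_derive_0_is_cst R _ s 0 cst0.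
rewrite expr0n/= mul0r expR0 mulr1.
have -> : G l 0 = Num.sqrt (pi / l).
  rewrite -Rintegral_gauss//; apply: eq_Rintegral => x _.
  by rewrite mul0r cos0 mul1r.
by move=> <-; rewrite -mulrA -expRD subrr expR0 mulr1.
Qed.

(** Adding the Gaussian makes the integrand nonnegative, so that the line can be folded; the odd
    sine part then cancels. *)
Lemma Rintegral_gauss_sin (l s : R) : 0 < l ->
  \int[mu]_x (sin (s * x) * expR (- (l * x ^+ 2))) = 0.
Proof.
move=> l0.
have ii : mu.-integrable setT (EFin \o (fun x => sin (s * x) * e l x)).
  apply: integrable_quad_decay; last exact/quad_decay_sin/quad_decay_gauss.
  by have mel := me l; meas.
have ei := integrable_gauss l0.
have : \int[mu]_x (e l x + sin (s * x) * e l x) = \int[mu]_x e l x.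
  rewrite /Rintegral; congr fine; rewrite !ge0_integralT_fold.
  - apply: eq_integral => x _; rewrite /e mulrN sinN sqrrN; congr EFin; ring.
  - exact: continuous_gauss.
  - by move=> x; exact: expR_ge0.
  - by rewrite /e; cont.
  - move=> x; have := mulr_ge0 (expR_ge0 (- (l * x ^+ 2))) (trig_ge0 false (s * x)).
    have -> : e l x + sin (s * x) * e l x = e l x * (1 + sin (s * x)) by ring.
    by [].
by rewrite RintegralD// => /eqP; rewrite -subr_eq0 addrC addKr => /eqP.
Qed.

Lemma Rintegral_gauss_trig b (l s : R) : 0 < l ->
  \int[mu]_x (trig b (s * x) * expR (- (l * x ^+ 2))) =
  b%:R * (Num.sqrt (pi / l) * expR (- (s ^+ 2 / (4 * l)))).
Proof.
case: b => l0 /=; first by rewrite Rintegral_gauss_cos// mul1r.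
by rewrite Rintegral_gauss_sin// mul0r.
Qed.

(** The extended, nonnegative form of the transform, as needed inside Tonelli's theorem. *)
Lemma integral_gauss_trig b (l s : R) : 0 < l ->
  (\int[mu]_x ((1 + trig b (s * x)) * expR (- (l * x ^+ 2)))%:E =
  (Num.sqrt (pi / l) * (1 + b%:R * expR (- (s ^+ 2 / (4 * l)))))%:E)%E.
Proof.
move=> l0; have ei := integrable_gauss l0.
have ti : mu.-integrable setT (EFin \o (fun x => trig b (s * x) * e l x)).
  apply: integrable_quad_decay.
    by have mel := me l; have mt := @measurable_continuous _ setT _ (@continuous_trig b); meas.
  by apply: (@quad_decayM _ _ _ 1); [move=> x; exact: trig_le1|exact: quad_decay_gauss].
rewrite mulrDr mulr1 mulrCA -Rintegral_gauss_trig// -Rintegral_gauss//.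
rewrite -RintegralD// fineK.
  by apply: eq_integral => x _; congr EFin; rewrite mulrDl mul1r.
by apply: integrable_fin_num => //; have := integrableD measurableT ei ti.
Qed.

(* The outer integral is regularized by the factor [expR (- (eps * y) ^+ 2)]. *)
Lemma fourier_inversion0 b (g : R -> R) : continuous g -> quad_decay g ->
  mu.-integrable setT (EFin \o (fun y => \int[mu]_w (g w * trig b (y * w)))) ->
  \int[mu]_y \int[mu]_w (g w * trig b (y * w)) = b%:R * (2 * pi * g 0).
Proof.
move=> cg qg; set Phi := fun y => _ => iPhi.
have mg := @measurable_continuous _ setT _ cg.
have mt := @measurable_continuous _ setT _ (@continuous_trig b).
have gi := integrable_quad_decay mg qg.
have gni : mu.-integrable setT (EFin \o (fun w => `|g w|)) by exact: integrable_norm.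
have mPhi : measurable_fun setT Phi.
  by apply/measurable_EFinP; exact: measurable_int iPhi.
pose eps n : R := n.+1%:R^-1.
have eps0 n : 0 < eps n by rewrite invr_gt0.
have epsc : eps n @[n --> \oo] --> 0 by exact: cvg_harmonic.
have e2 n : 0 < eps n ^+ 2 by rewrite exprn_gt0.
have H1 : \int[mu]_y (Phi y * e (eps n ^+ 2) y) @[n --> \oo] --> \int[mu]_y Phi y.
  have [] := @dominated_convergence _ _ R mu setT measurableT
    (fun n y => (Phi y * e (eps n ^+ 2) y)%:E) (EFin \o Phi) (abse \o (EFin \o Phi)).
  - by move=> n; have mel := me (eps n ^+ 2); meas.
  - exact/measurable_EFinP.
  - apply: aeW => y _; apply: cvg_EFin; first exact: nearW.
    rewrite -[X in _ --> X]mulr1; apply: cvgMr.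
    have h : - (eps n ^+ 2 * y ^+ 2) @[n --> \oo] --> 0.
      rewrite -oppr0 -[X in - X](mul0r (y ^+ 2)).
      apply: cvgN; apply: cvgMl; rewrite -(mulr0 0); exact: cvgM.
    by have := cvg_comp _ _ h (@continuous_expR R 0); rewrite expR0.
  - exact: integrable_abse.
  - apply: aeW => y n _; rewrite /= lee_fin normrM ler_piMr//.
    rewrite ger0_norm ?expR_ge0// -expR0 ler_expR oppr_le0 mulr_ge0 ?sqr_ge0//.
  move=> _ _ h; rewrite /Rintegral; apply: fine_cvg.
  by rewrite fineK; [exact: h|exact: integrable_fin_num].
(* With the regularizing factor the double integral is dominated by a product, so the integral in
   [y] can be taken first; it is a Gaussian transform. *)
have H2 n : \int[mu]_y (Phi y * e (eps n ^+ 2) y) =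
    b%:R * (2 * Num.sqrt pi * \int[mu]_z (g (2 * eps n * z) * gauss_fun z)).
  transitivity (\int[mu]_y \int[mu]_w (g w * trig b (y * w) * e (eps n ^+ 2) y)).
    apply: eq_Rintegral => y _; rewrite -RintegralZr//.
    apply: (le_integrable measurableT _ _ gni).
      by apply/measurable_EFinP; meas.
    by move=> w _ /=; rewrite lee_fin normrM normr_id ler_piMr// trig_le1.
  rewrite (@Rintegral_Fubini _ _ _ _ _ mu mu _ (e (eps n ^+ 2)) (fun w => `|g w|))//.
  - transitivity (\int[mu]_w (b%:R * Num.sqrt (pi / eps n ^+ 2) *
       (g w * expR (- (w ^+ 2 / (4 * eps n ^+ 2)))))).
      apply: eq_Rintegral => w _.
      transitivity (\int[mu]_y (g w * (trig b (w * y) * e (eps n ^+ 2) y))).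
        by apply: eq_Rintegral => y _; rewrite mulrA (mulrC y w).
      rewrite RintegralZl//; last first.
        apply: integrable_quad_decay; first by have mel := me (eps n ^+ 2); meas.
        apply: (@quad_decayM _ _ _ 1); first by move=> y; exact: trig_le1.
        exact: quad_decay_gauss.
      by rewrite Rintegral_gauss_trig//; ring.
    have qf : quad_decay (fun w => g w * expR (- (w ^+ 2 / (4 * eps n ^+ 2)))).
      apply: (@quad_decay_eq _ (fun w => expR (- (w ^+ 2 / (4 * eps n ^+ 2))) * g w)).
        by move=> w; rewrite mulrC.
      apply: (@quad_decayM _ _ _ 1) qg => w; rewrite ger0_norm ?expR_ge0// -expR0 ler_expR.
      by rewrite oppr_le0 divr_ge0 ?sqr_ge0// mulr_ge0// ltW.
    have cf : continuous (fun w => g w * expR (- (w ^+ 2 / (4 * eps n ^+ 2)))) by cont.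
    have fi : mu.-integrable setT (EFin \o (fun w => g w * expR (- (w ^+ 2 / (4 * eps n ^+ 2))))).
      by apply: integrable_quad_decay qf; apply: measurable_continuous.
    (* The scaling [w = 2 eps z] turns the kernel into the standard Gaussian, and its Jacobian
       cancels the [1 / eps] contained in [sqrt (pi / eps^2)]. *)
    have a0 : 0 < 2 * eps n by rewrite mulr_gt0.
    rewrite RintegralZl// (Rintegral_affine 0 a0 cf fi).
    rewrite (sqrtrM _ (pi_ge0 R)) (sqrtrV (ltW (e2 n))) sqrtr_sqr (ger0_norm (ltW (eps0 n))).
    rewrite (_ : \int[mu]_x _ = \int[mu]_z (g (2 * eps n * z) * gauss_fun z)).
      by field; rewrite gt_eqF.
    apply: eq_Rintegral => z _; rewrite addr0 /gauss_fun; congr (_ * expR _).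
    by field; rewrite gt_eqF.
  - by have mel := me (eps n ^+ 2); meas.
  - exact: integrable_gauss.
  - move=> y w; rewrite normrM [X in _ <= X]mulrC (ger0_norm (expR_ge0 _)).
    by rewrite ler_wpM2r ?expR_ge0// normrM ler_piMr// trig_le1.
(* The Gaussian acts as an approximate identity at 0. Its mass [sqrt pi] and the prefactor
   [2 sqrt pi] combine to the [2 pi] of the statement. *)
have H3 : \int[mu]_z (g (2 * eps n * z) * gauss_fun z) @[n --> \oo] --> g 0 * Num.sqrt pi.
  have [C gC] := quad_decay_bounded qg.
  have gaussi := @integrableT_gauss R.
  have mgauss := @measurable_gauss_fun R.
  have [] := @dominated_convergence _ _ R mu setT measurableT
    (fun n z => (g (2 * eps n * z) * gauss_fun z)%:E) (fun z => (g 0 * gauss_fun z)%:E)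
    (fun z => C%:E * (gauss_fun z)%:E)%E.
  - by move=> n; meas.
  - by meas.
  - apply: aeW => z _; apply: cvg_EFin; first exact: nearW.
    apply: cvgMl.
    have h : 2 * eps n * z @[n --> \oo] --> 0.
      by rewrite -(mul0r z) -(mulr0 2); apply: cvgMl; apply: cvgMr.
    exact: (cvg_comp _ _ h (cg 0)).
  - exact: integrableZl.
  - apply: aeW => z n _; rewrite lee_fin normrM (ger0_norm (gauss_fun_ge0 _)).
    by rewrite ler_wpM2r ?gauss_fun_ge0.
  move=> i0 _ h.
  have -> : g 0 * Num.sqrt pi = \int[mu]_z (g 0 * gauss_fun z).
    by rewrite RintegralZl// /Rintegral integralT_gauss.
  rewrite /Rintegral; apply: fine_cvg.
  by rewrite fineK; [exact: h|exact: integrable_fin_num].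
suff H4 : \int[mu]_y (Phi y * e (eps n ^+ 2) y) @[n --> \oo] --> b%:R * (2 * pi * g 0).
  exact: (cvg_unique _ H1 H4).
rewrite [X in X @ _ --> _](funext H2).
have -> : b%:R * (2 * pi * g 0) = b%:R * (2 * Num.sqrt pi * (g 0 * Num.sqrt pi)).
  by rewrite -[in LHS](@sqr_sqrtr R pi) ?pi_ge0//; ring.
by apply: cvgMr; apply: cvgMr.
Qed.


End gauss_fourier.

(** * The Gamma function on vertical lines *)

Section gamma.
Variable R : realType.
Notation mu := (@lebesgue_measure R).

(** The splitting [(|f| + f) - |f|] again, with integrability now known after the substitution and
    deduced before it. *)
Lemma Rintegral_expR (f : R -> R) : (forall u : R, 0 < u -> {for u, continuous f}) ->
  mu.-integrable setT (fun w => (f (expR w) * expR w)%:E) ->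
  \int[mu]_(u in [set u | 0 < u]) f u = \int[mu]_w (f (expR w) * expR w).
Proof.
move=> cf fi; set D := [set u : R | 0 < u].
have mD : measurable D by rewrite /D -set_itvoy; exact: measurable_itv.
have mf : measurable_fun D f.
  apply: open_continuous_measurable_fun.
    by rewrite /D -set_itvoy; exact: interval_open.
  by move=> u; rewrite inE; exact: cf.
have sub (g : R -> R) : (forall u : R, 0 < u -> {for u, continuous g}) ->
    (forall x, 0 <= g x) -> measurable_fun D g ->
    mu.-integrable setT (fun w => (g (expR w) * expR w)%:E) ->
    mu.-integrable D (EFin \o g) /\
    \int[mu]_(u in D) g u = \int[mu]_w (g (expR w) * expR w).
  move=> cg g0 mg gi; have e := ge0_integralT_expR cg (fun x _ => g0 x).
  split; last by rewrite /Rintegral e.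
  apply/integrableP; split; first exact/measurable_EFinP.
  under eq_integral do rewrite gee0_abs ?lee_fin//.
  rewrite e ltey_eq; apply/orP; left.
  exact: integrable_fin_num gi.
have cn (u : R) : 0 < u -> {for u, continuous (fun x => `|f x|)}.
  by move=> u0; apply: (@continuous_comp _ _ _ f Num.norm); [exact: cf|exact: norm_continuous].
have mn : measurable_fun D (fun x => `|f x|) by exact: measurable_fun_norm.
have fn : mu.-integrable setT (fun w => (`|f (expR w)| * expR w)%:E).
  apply: eq_integrable (integrable_norm fi) => // w _.
  by rewrite /= normrM (ger0_norm (expR_ge0 _)).
have nf : mu.-integrable setT (fun w => ((`|f (expR w)| + f (expR w)) * expR w)%:E).
  apply: eq_integrable (integrableD measurableT fn fi) => // w _.
  by rewrite /= -EFinD -mulrDl.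
have [i1 e1] := sub _ cn (fun x => normr_ge0 _) mn fn.
have [|||i2 e2] := sub (fun x => `|f x| + f x) _ _ _ nf.
- by move=> u u0; apply: (@continuousD _ _ _ (fun x => `|f x|) f); [exact: cn|exact: cf].
- by move=> x; rewrite -lerBlDr sub0r -normrN ler_norm.
- exact: measurable_funD.
have -> : \int[mu]_(x in D) f x = \int[mu]_(x in D) (`|f x| + f x) - \int[mu]_(x in D) `|f x|.
  by rewrite -RintegralB//; apply: eq_Rintegral => x _; rewrite addrAC subrr add0r.
rewrite e1 e2 -RintegralB//; apply: eq_Rintegral => x _.
by rewrite -mulrBl addrAC subrr add0r.
Qed.

Lemma continuous_powRl (a u : R) : 0 < u -> {for u, continuous (fun x : R => x `^ a)}.
Proof.
move=> u0; apply/differentiable_continuous/derivable1_diffP.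
by have := is_derive1_powR a u0 => -[].
Qed.

Lemma powR_expR (w a : R) : expR w `^ a = expR (a * w).
Proof. by rewrite mulrC expRM. Qed.

Lemma powR_expR_hexp (k w : R) :
  expR w `^ (k - 1) * expR (- expR w) * expR w = hexp k w.
Proof. by rewrite powR_expR -!expRD /hexp; congr expR; ring. Qed.

Lemma GammaR_hexp (k : R) : GammaR k = \int[mu]_w hexp k w.
Proof.
rewrite /GammaR /Rintegral ge0_integralT_expR.
- by congr fine; apply: eq_integral => w _; rewrite powR_expR_hexp.
- move=> x x0; apply: (@continuousM _ _ (fun u => u `^ (k - 1)) (fun u => expR (- u))).
    exact: continuous_powRl.
  by cont.
- by move=> x _; rewrite mulr_ge0 ?powR_ge0 ?expR_ge0.
Qed.

Lemma GammaR_gt0 (k : R) : 0 < k -> 0 < GammaR k.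
Proof.
move=> k0; rewrite GammaR_hexp.
have ki := integrable_hexp k0.
(* A lower bound for [hexp k] on [[0, 1]], where [k w - e^w >= - (|k| + e)]. *)
pose c : R := expR (- (`|k| + expR 1)).
have m01 : mu `[0%R, 1%R]%classic = 1%E.
  by rewrite lebesgue_measure_itv/= lte01 oppr0 adde0.
rewrite -lte_fin fineK; last exact: integrable_fin_num.
have mh : measurable_fun setT (EFin \o hexp k) by exact: measurable_int ki.
apply: (@lt_le_trans _ _ (\int[mu]_(w in `[0%R, 1%R]%classic) (hexp k w)%:E)%E); last first.
  by apply: ge0_subset_integral => // w _; rewrite lee_fin hexp_ge0.
apply: (@lt_le_trans _ _ (\int[mu]_(w in `[0%R, 1%R]%classic) (c)%:E)%E).
  rewrite integral_cst//; apply: mule_gt0; first by rewrite lte_fin expR_gt0.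
  by have : (0 < mu `[0%R, 1%R]%classic)%E by rewrite m01.
apply: ge0_le_integral => //.
- by move=> w _; rewrite lee_fin expR_ge0.
- exact: measurable_funTS.
- move=> w /=; rewrite in_itv/= => /andP[w0 w1]; rewrite lee_fin /c /hexp ler_expR.
  have : expR w <= expR 1 by rewrite ler_expR.
  have : 0 <= k * w by rewrite mulr_ge0// ltW.
  have := normr_ge0 k; lra.
Qed.

(** For [k > 0], the real part ([true]) or imaginary part ([false]) of [Gamma (k + i y)]. *)
Definition gammat (b : bool) (k y : R) : R := \int[mu]_w (hexp k w * trig b (y * w)).

Lemma integrable_hexp_trig b (k y : R) : 0 < k ->
  mu.-integrable setT (fun w => (hexp k w * trig b (y * w))%:E).
Proof.
move=> k0; apply: (le_integrable measurableT _ _ (integrable_hexp k0)).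
- have mh := @measurable_hexp R k.
  by have mt := @measurable_continuous _ setT _ (@continuous_trig R b); meas.
- by move=> w _ /=; rewrite lee_fin normrM ler_piMr// trig_le1.
Qed.

Lemma GammaC_gammat (k y : R) : 0 < k ->
  GammaC (Complex k y) = Complex (gammat true k y) (gammat false k y).
Proof.
move=> k0; rewrite /GammaC /cintegral.
have H b : \int[mu]_(u in [set u | 0 < u]) (u `^ (k - 1) * expR (- u) * trig b (y * ln u)) =
    gammat b k y.
  rewrite Rintegral_expR.
  - apply: eq_Rintegral => w _; rewrite expRK mulrAC.
    by rewrite powR_expR_hexp.
  - move=> u u0; apply: (@continuousM _ _ (fun u => u `^ (k - 1) * expR (- u))
      (fun u => trig b (y * ln u))).
      apply: (@continuousM _ _ (fun u => u `^ (k - 1)) (fun u => expR (- u))).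
        exact: continuous_powRl.
      by cont.
    apply: (@continuous_comp _ _ _ (fun u => y * ln u) (trig b)); last exact: continuous_trig.
    apply: continuousM; first exact: cst_continuous.
    exact: continuous_ln.
  - apply: eq_integrable (integrable_hexp_trig b y k0) => // w _.
    by rewrite expRK mulrAC powR_expR_hexp.
rewrite -!H; congr Complex; apply: eq_Rintegral => u _ /=; rewrite subr0 mulr0 ?subr0 ?add0r ?addr0; ring.
Qed.

(** Tonelli's theorem gives measurability of partial integrals of nonnegative functions, whence the
    added 1, subtracted again as [GammaR k]. *)
Lemma measurable_gammat b (k : R) : 0 < k -> measurable_fun setT (gammat b k).
Proof.
move=> k0; have mh := @measurable_hexp R k.
have mt := @measurable_continuous _ setT _ (@continuous_trig R b).
have -> : gammat b k = fun y => fine (\int[mu]_w (hexp k w * (1 + trig b (y * w)))%:E)%E - GammaR k.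
  apply/funext => y; rewrite GammaR_hexp /gammat -RintegralB//; last 2 first.
  - have := integrableD measurableT (integrable_hexp k0) (integrable_hexp_trig b y k0).
    by apply: eq_integrable => // w _; rewrite /= -EFinD mulrDr mulr1.
  - exact: integrable_hexp.
  by apply: eq_Rintegral => w _; rewrite mulrDr mulr1 addrAC subrr add0r.
apply: measurable_funD => //; apply: measurableT_comp => //.
apply: (@measurable_fun_fubini_tonelli_F _ _ _ _ _ mu
  (fun z : R * R => (hexp k z.2 * (1 + trig b (z.1 * z.2)))%:E)).
- by meas.
- by move=> z; rewrite lee_fin mulr_ge0 ?hexp_ge0 ?trig_ge0.
Qed.

Lemma is_derive_hexp (k w : R) : is_derive w 1 (hexp k) (k * hexp k w - hexp (k + 1) w).
Proof.
rewrite hexpD mul1r /hexp; apply: is_derive_eq; rewrite /GRing.scale/=; ring.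
Qed.

Lemma quad_decay_gammat b (k : R) : 0 < k -> quad_decay (gammat b k).
Proof.
move=> k0.
(* Two applications of [(hexp k)' = k hexp k - hexp (k + 1)]. *)
pose h2 w := k ^+ 2 * hexp k w + (- (2 * k + 1) * hexp (k + 1) w + hexp (k + 2) w).
have k1 : 0 < k + 1 by rewrite addr_gt0.
have k2 : 0 < k + 2 by rewrite addr_gt0.
have q0 := quad_decay_hexp k0; have q1 := quad_decay_hexp k1; have q2 := quad_decay_hexp k2.
have qh2 : quad_decay h2.
  by apply: quad_decayD; [exact: quad_decayZ|apply: quad_decayD => //; exact: quad_decayZ].
have mh0 := @measurable_hexp R k; have mh1 := @measurable_hexp R (k + 1).
have mh2 := @measurable_hexp R (k + 2).
have mt := @measurable_continuous _ setT _ (@continuous_trig R b).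
have mH2 : measurable_fun setT h2 by rewrite /h2; meas.
have c0 := @continuous_hexp R k; have c1 := @continuous_hexp R (k + 1).
have c2 := @continuous_hexp R (k + 2).
have ih2 := integrable_quad_decay mH2 qh2.
have it y : mu.-integrable setT (fun w => (h2 w * trig b (y * w))%:E).
  apply: (le_integrable measurableT _ _ ih2); first by meas.
  by move=> w _ /=; rewrite lee_fin normrM ler_piMr// trig_le1.
have ht y := integrable_hexp_trig b y k0.
(* Two integrations by parts, [h2] being the second derivative of [hexp k]. *)
have main y : y ^+ 2 * gammat b k y = - \int[mu]_w (h2 w * trig b (y * w)).
  apply/eqP; rewrite -subr_eq0 opprK; apply/eqP.
  rewrite /gammat -RintegralZl//; last exact: ht.
  have ii := integrableD measurableT (integrableZl measurableT (y ^+ 2) (ht y)) (it y).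
  rewrite -RintegralD//; last 2 first.
  - exact: (integrableZl measurableT (y ^+ 2) (ht y)).
  - exact: it.
  pose h1 w := k * hexp k w - hexp (k + 1) w.
  have q1' : quad_decay h1.
    apply: (@quad_decay_eq _ (fun w => k * hexp k w + -1 * hexp (k + 1) w)).
      by move=> w; rewrite mulN1r.
    by apply: quad_decayD; exact: quad_decayZ.
  have dh1 (w : R) : is_derive w 1 h1 (h2 w).
    have d0 := is_derive_hexp k w; have d1 := is_derive_hexp (k + 1) w.
    rewrite /h1 /h2; apply: is_derive_eq.
    by rewrite /GRing.scale/= -addrA -[1 + 1]/2; ring.
  (* The mixed terms containing [y * h1] cancel in the derivative, so this single primitive performs
     both integrations by parts. *)
  pose F w := if b then y * (sin (y * w) * hexp k w) + cos (y * w) * h1 w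
              else - y * (cos (y * w) * hexp k w) + sin (y * w) * h1 w.
  apply: (@Rintegral_derive_eq0 R F).
  - move=> w; have d0 := is_derive_hexp k w; have d1 := dh1 w.
    rewrite /F /trig; case: (b); apply: is_derive_eq; rewrite /GRing.scale/= /h1; ring.
  - by have ct := @continuous_trig R b; rewrite /h2; cont.
  - exact: ii.
  - rewrite /F; case: (b); apply: quad_decayD.
    + by apply: quad_decayZ; exact: quad_decay_sin.
    + exact: quad_decay_cos.
    + by apply: quad_decayZ; exact: quad_decay_cos.
    + exact: quad_decay_sin.
exists (\int[mu]_w hexp k w + \int[mu]_w `|h2 w|) => y.
rewrite mulrDr mulr1 lerD//.
  apply: (le_trans (le_normr_Rintegral measurableT (ht y))).
  apply: le_Rintegral => //; first exact: (integrable_norm (ht y)).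
    exact: integrable_hexp.
  by move=> w _; rewrite normrM (ger0_norm (hexp_ge0 _ _)) ler_piMr ?hexp_ge0// trig_le1.
rewrite -[in X in _ * X](ger0_norm (sqr_ge0 y)) -normrM mulrC main normrN.
apply: (le_trans (le_normr_Rintegral measurableT (it y))).
apply: le_Rintegral => //; first exact: (integrable_norm (it y)).
  exact: (integrable_norm ih2).
by move=> w _; rewrite normrM ler_piMr// trig_le1.
Qed.

Lemma integrable_gammat b (k : R) : 0 < k -> mu.-integrable setT (EFin \o gammat b k).
Proof.
by move=> k0; apply: integrable_quad_decay; [exact: measurable_gammat|exact: quad_decay_gammat].
Qed.

(** Translating [hexp k] by [v] multiplies its transform by [e^(- i y v)]; the right-hand side is
    the real or imaginary part of [Gamma (k + i y) e^(- i y v)]. *)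
Lemma gammat_shift b (k v y : R) : 0 < k ->
  \int[mu]_w (hexp k (w + v) * trig b (y * w)) =
  if b then gammat true k y * cos (y * v) + gammat false k y * sin (y * v)
  else gammat false k y * cos (y * v) - gammat true k y * sin (y * v).
Proof.
move=> k0.
have it c u := integrable_hexp_trig c u k0.
have ch := @continuous_hexp R k; have ct := @continuous_trig R b.
transitivity (\int[mu]_w (hexp k w * trig b (y * (w - v)))).
  rewrite [RHS](@Rintegral_affine R 1 v)//; first 1 last.
  - by cont.
  - apply: (le_integrable measurableT _ _ (integrable_hexp k0)).
      by apply/measurable_EFinP; apply: measurable_continuous; cont.
    by move=> w _ /=; rewrite lee_fin normrM ler_piMr// trig_le1.
  by rewrite mul1r; apply: eq_Rintegral => w _; rewrite mul1r addrK.
rewrite /gammat; case: b {ct} => /=.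
  rewrite -!RintegralZr//; try exact: it true _; try exact: it false _.
  rewrite -RintegralD//; last 2 first.
  - exact: integrableZr (it true y).
  - exact: integrableZr (it false y).
  by apply: eq_Rintegral => w _; rewrite mulrBr cosB; ring.
rewrite -!RintegralZr//; try exact: it true _; try exact: it false _.
rewrite -RintegralB//; last 2 first.
- exact: integrableZr (it false y).
- exact: integrableZr (it true y).
by apply: eq_Rintegral => w _; rewrite mulrBr sinB; ring.
Qed.

Lemma integrable_mul_trig b (v : R) (f : R -> R) : mu.-integrable setT (EFin \o f) ->
  mu.-integrable setT (fun y => (f y * trig b (y * v))%:E).
Proof.
move=> fi; have mf : measurable_fun setT f by apply/measurable_EFinP; exact: measurable_int fi.
have mt := @measurable_continuous _ setT _ (@continuous_trig R b).
apply: (le_integrable measurableT _ _ fi); first by meas.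
by move=> w _ /=; rewrite lee_fin normrM ler_piMr// trig_le1.
Qed.

(** Inversion at 0 applied to the translate [hexp k (w + v)]. This translate is a multiple of
    [expR (k w - e^v e^w)], hence still of quadratic decay. *)
Lemma cahen_mellin b (k v : R) : 0 < k ->
  \int[mu]_y (if b then gammat true k y * cos (y * v) + gammat false k y * sin (y * v)
  else gammat false k y * cos (y * v) - gammat true k y * sin (y * v)) =
  b%:R * (2 * pi * hexp k v).
Proof.
move=> k0; under eq_Rintegral do rewrite -gammat_shift//.
rewrite -[in RHS](add0r v) (@fourier_inversion0 R b (fun w => hexp k (w + v)))//.
- by have ch := @continuous_hexp R k; cont.
- apply: (@quad_decay_eq _ (fun w => expR (k * v) * expR (k * w - expR v * expR w))).
    by move=> w; rewrite /hexp (expRD w v) -[LHS]expRD; congr expR; ring.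
  by apply: quad_decayZ; apply: quad_decay_expR_expR => //; exact: expR_gt0.
- suff : mu.-integrable setT (EFin \o (fun y =>
      if b then gammat true k y * cos (y * v) + gammat false k y * sin (y * v)
      else gammat false k y * cos (y * v) - gammat true k y * sin (y * v))).
    by apply: eq_integrable => // y _; rewrite /= gammat_shift.
  have i c d := @integrable_mul_trig d v _ (@integrable_gammat c k k0).
  case: (b).
    exact: (integrableD measurableT (i true true) (i false false)).
  exact: (integrableB measurableT (i false true) (i true false)).
Qed.

End gamma.

(** * Mellin-Barnes integrals *)

Section mellin_barnes.
Variable R : realType.
Notation mu := (@lebesgue_measure R).

(** Gamma commutes with complex conjugation. On the contour the factors [Gamma (b - s)] have
    imaginary argument [- y]. *)
Lemma gammat_opp b (k y : R) : 0 < k ->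
  gammat b k (- y) = (if b then 1 else -1) * gammat b k y.
Proof.
move=> k0; rewrite /gammat -RintegralZl//; last exact: integrable_hexp_trig.
apply: eq_Rintegral => w _; case: b => /=; first by rewrite mulNr cosN mul1r.
by rewrite mulNr sinN mulN1r mulrN.
Qed.

Lemma integrable_mul_gammat b (k : R) (f : R -> R) : 0 < k ->
  mu.-integrable setT (EFin \o f) -> mu.-integrable setT (fun y => (f y * gammat b k y)%:E).
Proof.
move=> k0 fi; have mf : measurable_fun setT f by apply/measurable_EFinP; exact: measurable_int fi.
have mg := @measurable_gammat R b k k0.
have [C gC] := quad_decay_bounded (@quad_decay_gammat R b k k0).
apply: (@le_integrable _ _ _ mu setT measurableT _ (fun y => C%:E * (f y)%:E)%E).
- by meas.
- move=> y _ /=; rewrite lee_fin !normrM mulrC ler_wpM2r//.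
  by apply: le_trans (gC y) (ler_norm _).
- exact: integrableZl.
Qed.

(** With [K = K1 + i K2], the new integrand is [K] times the conjugate of [Gamma (b + i y)].
    Expanding that Gamma as an integral in [w] and exchanging, the inner integral is the hypothesis
    at [v + w]; its weight [e^(c (v + w))] raises the exponent [b] to [b + c]. *)
Lemma fourier_gamma_step (M c b : R) (K1 K2 H : R -> R) : 0 < M -> 0 < b ->
  mu.-integrable setT (EFin \o K1) -> mu.-integrable setT (EFin \o K2) ->
  (forall v, \int[mu]_y (K1 y * cos (y * v) + K2 y * sin (y * v)) = M * expR (c * v) * H v) ->
  forall v, \int[mu]_y
    ((K1 y * gammat true b y + K2 y * gammat false b y) * cos (y * v) +
     (K2 y * gammat true b y - K1 y * gammat false b y) * sin (y * v)) =
  M * expR (c * v) * \int[mu]_w (hexp (b + c) w * H (v + w)).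
Proof.
move=> M0 b0 i1 i2 KH v.
have m1 : measurable_fun setT K1 by apply/measurable_EFinP; exact: measurable_int i1.
have m2 : measurable_fun setT K2 by apply/measurable_EFinP; exact: measurable_int i2.
have mh := @measurable_hexp R b.
pose k y w := hexp b w * (K1 y * cos (y * (v + w)) + K2 y * sin (y * (v + w))).
have mk : measurable_fun setT (fun z : R * R => k z.1 z.2) by rewrite /k; meas.
have ni : mu.-integrable setT (EFin \o (fun y => `|K1 y| + `|K2 y|)).
  exact: (integrableD measurableT (integrable_norm i1) (integrable_norm i2)).
have hi := integrable_hexp b0.
have kb y w : `|k y w| <= (`|K1 y| + `|K2 y|) * hexp b w.
  rewrite /k normrM (ger0_norm (hexp_ge0 _ _)) mulrC ler_wpM2r ?hexp_ge0//.
  apply: le_trans (ler_normD _ _) _; rewrite !normrM lerD// ler_piMr//.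
    exact: (trig_le1 true).
  exact: (trig_le1 false).
have inner w : \int[mu]_y k y w = M * expR (c * v) * (hexp (b + c) w * H (v + w)).
  rewrite /k RintegralZl//; last first.
    exact: (integrableD measurableT (integrable_mul_trig true (v + w) i1)
      (integrable_mul_trig false (v + w) i2)).
  by rewrite KH hexpD mulrDr expRD; ring.
(* Integrability is inherited from the inner Fubini integral, of which this function is a constant
   multiple. *)
have iw : mu.-integrable setT (EFin \o (fun w => hexp (b + c) w * H (v + w))).
  have iI : mu.-integrable setT (EFin \o (fun w => \int[mu]_y k y w)).
    apply: (@integrable_Rintegral_l R _ _ _ _ mu mu (fun w y => k y w) (hexp b)
      (fun y => `|K1 y| + `|K2 y|)) => //.
      by rewrite /k; meas.
    by move=> w y; rewrite mulrC.
  have := integrableZl measurableT (M * expR (c * v))^-1 iI.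
  apply: eq_integrable => // w _.
  by rewrite /= -EFinM inner mulKf// gt_eqF// mulr_gt0// expR_gt0.
rewrite -RintegralZl//; under [RHS]eq_Rintegral do rewrite -inner.
rewrite -(@Rintegral_Fubini R _ _ _ _ mu mu k (fun y => `|K1 y| + `|K2 y|) (hexp b))//; apply: eq_Rintegral => y _.
have ht b' := integrable_hexp_trig b' y b0.
(* [A + i B] is [K e^(- i y v)]. *)
pose A := K1 y * cos (y * v) + K2 y * sin (y * v).
pose B := K2 y * cos (y * v) - K1 y * sin (y * v).
transitivity (A * gammat true b y + B * gammat false b y); first by rewrite /A /B; ring.
rewrite /gammat -!RintegralZl//; [|exact: ht..].
rewrite -RintegralD//; last 2 first.
- exact: (integrableZl measurableT A (ht true)).
- exact: (integrableZl measurableT B (ht false)).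
apply: eq_Rintegral => w _; rewrite /k /A /B (mulrDr y v w) cosD sinD /=; ring.
Qed.

(* The real and imaginary parts of
   [(2 pi)^-1 int_R K y e^(- (c + i y) v) dy = H v]. *)
Definition fourier_pair (c : R) (K : R -> R[i]) (H : R -> R) :=
  [/\ mu.-integrable setT (EFin \o (fun y => complex.Re (K y))),
      mu.-integrable setT (EFin \o (fun y => complex.Im (K y))),
      forall v, \int[mu]_y (complex.Re (K y) * cos (y * v) + complex.Im (K y) * sin (y * v)) =
        2 * pi * expR (c * v) * H v
    & forall v, \int[mu]_y (complex.Im (K y) * cos (y * v) - complex.Re (K y) * sin (y * v)) = 0].

Lemma fourier_pair_GammaC (c : R) : 0 < c ->
  fourier_pair c (fun y => GammaC (Complex c y)) (fun v => expR (- expR v)).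
Proof.
move=> c0; split.
- by apply: eq_integrable (integrable_gammat true c0) => // y _; rewrite /comp GammaC_gammat.
- by apply: eq_integrable (integrable_gammat false c0) => // y _; rewrite /comp GammaC_gammat.
- move=> v; under eq_Rintegral do rewrite GammaC_gammat//=.
  by rewrite (cahen_mellin true)// mul1r /hexp expRD mulrA.
- move=> v; under eq_Rintegral do rewrite GammaC_gammat//=.
  by rewrite (cahen_mellin false)// mul0r.
Qed.

Lemma fourier_pairM (c b : R) K H : 0 < b -> fourier_pair c K H ->
  fourier_pair c (fun y => K y * GammaC (Complex b (- y)))
    (fun v => \int[mu]_w (hexp (b + c) w * H (v + w))).
Proof.
move=> b0 [i1 i2 KH K0]; have M0 : 0 < 2 * pi :> R by rewrite mulr_gt0// pi_gt0.
have E y : K y * GammaC (Complex b (- y)) =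
    Complex (complex.Re (K y) * gammat true b y + complex.Im (K y) * gammat false b y)
            (complex.Im (K y) * gammat true b y - complex.Re (K y) * gammat false b y).
  rewrite GammaC_gammat// !gammat_opp// mul1r mulN1r; case: (K y) => u w /=.
  by apply/eqP; rewrite eq_complex /=; apply/andP; split; apply/eqP; ring.
have j1 := integrable_mul_gammat _ b0 i1; have j2 := integrable_mul_gammat _ b0 i2.
split.
- by apply: eq_integrable (integrableD measurableT (j1 true) (j2 false)) => // y _; rewrite /= E.
- by apply: eq_integrable (integrableB measurableT (j2 true) (j1 false)) => // y _; rewrite /= E.
- move=> v; under eq_Rintegral do rewrite E/=.
  by rewrite (fourier_gamma_step M0 b0 i1 i2 KH).
- move=> v; under eq_Rintegral do rewrite E/=.
  (* The imaginary part of the transform of [K] is the real part of that of [- i K], which is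
     represented by [H = 0]. *)
  have := @fourier_gamma_step (2 * pi) c b (fun y => complex.Im (K y))
    (fun y => - complex.Re (K y)) (fun=> 0) M0 b0 i2 (integrableN i1) _ v.
  rewrite (_ : \int[mu]_w (_ * 0) = 0); last first.
    by under eq_Rintegral do rewrite mulr0; rewrite Rintegral_cst// mul0r.
  rewrite mulr0 => <-.
    by apply: eq_Rintegral => y _; ring.
  by move=> u; rewrite mulr0 -(K0 u); apply: eq_Rintegral => y _; ring.
Qed.

(** The substitution [x = e^(p / 2)] in the Gaussian integral of rate [l]; the factor [hexp 2^-1]
    already contains [e^(- e^p)], which leaves the rate [l - 1]. *)
Lemma Rintegral_hexp_half (l : R) : 0 < l ->
  \int[mu]_p (hexp 2^-1 p * expR (- (expR p * (l - 1)))) = Num.sqrt (pi / l).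
Proof.
move=> l0; rewrite -Rintegral_gauss// /Rintegral; congr fine.
have cg := @continuous_gauss R l.
have g0 x : 0 <= expR (- (l * x ^+ 2)) :> R by exact: expR_ge0.
rewrite (@ge0_integralT_fold _ (fun x => expR (- (l * x ^+ 2))))//.
under [RHS]eq_integral do rewrite sqrrN -mulr2n -mulr_natl.
rewrite -set_itvcy -integral_itv_obnd_cbnd; last first.
  by apply/measurable_EFinP; apply: measurable_continuous; cont.
have <- : [set x : R | 0 < x] = `]0, +oo[%classic by rewrite set_itvoy.
rewrite ge0_integralT_expR; last 2 first.
- by move=> x _; cont.
- by move=> x _; rewrite mulr_ge0.
rewrite [RHS](@ge0_integralT_affine _ 2^-1 0
  (fun x => 2 * expR (- (l * expR x ^+ 2)) * expR x)); last 3 first.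
- by rewrite invr_gt0.
- by cont.
- by move=> x; rewrite !mulr_ge0// expR_ge0.
rewrite -ge0_integralZl//; last first.
  by apply/measurable_EFinP; apply: measurable_continuous; cont.
apply: eq_integral => p _; rewrite -EFinM; congr EFin; rewrite addr0.
have aux (A B : R) : 2^-1 * (2 * A * B) = A * B by field.
rewrite aux /hexp -expRM_natl -!expRD; congr expR.
have -> : 2%:R * (2^-1 * p) = p by rewrite mulrA mulfV// mul1r.
ring.
Qed.

(** Written at [- ln x] to match the kernel [e^(- i y v)] of [fourier_pair] with [v = - ln x]. *)
Lemma mul_cpowR (z : R[i]) (x c y : R) : z * cpowR x (Complex c y) =
  Complex (x `^ c * (complex.Re z * cos (y * - ln x) + complex.Im z * sin (y * - ln x)))
    (x `^ c * (complex.Im z * cos (y * - ln x) - complex.Re z * sin (y * - ln x))).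
Proof.
rewrite mulrN cosN sinN /cpowR /=; case: z => k1 k2.
by apply/eqP; rewrite eq_complex/=; apply/andP; split; apply/eqP; ring.
Qed.

(** The abscissa drops out: [x^c] times the weight [e^((c + 1 - a) v)] at [v = - ln x] is
    [x^(a - 1)], and the exponents add up to [(b - c) + (c + 1 - a)]. *)
Lemma MeijerG31_13_hexp (x a b1 b2 b3 : R) : 0 < x ->
  a - 1 < b1 -> a - 1 < b2 -> a - 1 < b3 ->
  MeijerG31_13 x a b1 b2 b3 = (x `^ (a - 1) *
    \int[mu]_u (hexp (b2 + 1 - a) u *
      \int[mu]_v (hexp (b3 + 1 - a) v *
        \int[mu]_p (hexp (b1 + 1 - a) p * expR (- expR (- ln x + u + v + p))))))%:C%C.
Proof.
move=> x0 ab1 ab2 ab3; rewrite /MeijerG31_13.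
set c := (a - 1 + _) / 2.
have mb : a - 1 < Num.min b1 (Num.min b2 b3) by rewrite !lt_min ab1 ab2.
have ac : 0 < c + 1 - a by rewrite /c; lra.
have cm : c < Num.min b1 (Num.min b2 b3) by rewrite /c; lra.
have [c1 c2 c3] : [/\ 0 < b1 - c, 0 < b2 - c & 0 < b3 - c].
  by move: cm; rewrite !lt_min => /and3P[*]; rewrite !subr_gt0.
(* The factor of [b1] is adjoined first, which makes its integral the innermost one, ready for
   evaluation when [b1 = a - 1/2]. *)
have P := fourier_pairM c2 (fourier_pairM c3 (fourier_pairM c1 (fourier_pair_GammaC ac))).
move: P; set K := fun y : R => _; set H := fun v : R => _ => -[i1 i2 KH K0].
have subE b y : b%:C%C - Complex c y = Complex (b - c) (- y).
  by apply/eqP; rewrite eq_complex/= eqxx sub0r eqxx.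
have E y : GammaC (b1%:C%C - Complex c y) * GammaC (b2%:C%C - Complex c y) *
    GammaC (b3%:C%C - Complex c y) * GammaC ((1 - a)%:C%C + Complex c y) *
    cpowR x (Complex c y) =
    Complex (x `^ c * (complex.Re (K y) * cos (y * - ln x) + complex.Im (K y) * sin (y * - ln x)))
      (x `^ c * (complex.Im (K y) * cos (y * - ln x) - complex.Re (K y) * sin (y * - ln x))).
  rewrite !subE.
  have -> : (1 - a)%:C%C + Complex c y = Complex (c + 1 - a) y.
    by apply/eqP; rewrite eq_complex/= add0r eqxx andbT; apply/eqP; ring.
  (* Generalizing keeps the unifier from unfolding [GammaC] when it compares
     the ring structures of [R[i]]. *)
  rewrite -mul_cpowR /K; move: (GammaC _) (GammaC _) (GammaC _) (GammaC _) (cpowR _ _).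
  by move=> u1 u2 u3 u0 w; ring.
clearbody K.
have t v b' f := @integrable_mul_trig R b' v f.
rewrite /cintegral; under eq_Rintegral do rewrite E.
under [X in Complex _ X]eq_Rintegral do rewrite E.
rewrite /= RintegralZl//; last first.
  exact: (integrableD measurableT (t _ true _ i1) (t _ false _ i2)).
rewrite RintegralZl//; last first.
  exact: (integrableB measurableT (t _ true _ i2) (t _ false _ i1)).
rewrite KH K0 mulr0.
apply/eqP; rewrite eq_complex/= !mulr0 !mul0r subr0 addr0 eqxx andbT; apply/eqP.
have xE r : x `^ r = expR (r * ln x) by rewrite -powR_expR lnK.
have -> : x `^ c * (2 * pi * expR ((c + 1 - a) * - ln x) * H (- ln x)) =
    2 * pi * (x `^ (a - 1) * H (- ln x)).
  rewrite !xE; have -> : (a - 1) * ln x = c * ln x + (c + 1 - a) * - ln x by ring.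
  by rewrite expRD; ring.
rewrite mulKf; last by rewrite mulf_neq0// gt_eqF// pi_gt0.
have bE b : b - c + (c + 1 - a) = b + 1 - a by ring.
by rewrite /H !bE.
Qed.

(** For [b1 = a - 1/2] the innermost exponent is [1/2], and [Rintegral_hexp_half] applies with
    [l = 1 + e^(u + v) / x]. *)
Lemma MeijerG31_13_half (x a b2 b3 : R) : 0 < x ->
  a - 1 < b2 -> a - 1 < b3 ->
  MeijerG31_13 x a (a - 2^-1) b2 b3 = (x `^ (a - 1) *
    \int[mu]_u (hexp (b2 + 1 - a) u * \int[mu]_v (hexp (b3 + 1 - a) v *
      Num.sqrt (pi / (1 + expR (u + v) / x)))))%:C%C.
Proof.
move=> x0 ab2 ab3.
have ab1 : a - 1 < a - 2^-1 by rewrite ltrD2l ltrN2 invf_lt1 ?ltr1n.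
rewrite (MeijerG31_13_hexp x0 ab1 ab2 ab3).
congr (_ * _)%:C%C; apply: eq_Rintegral => u _; congr (_ * _).
apply: eq_Rintegral => v _; congr (_ * _).
have e0 : 0 < 1 + expR (u + v) / x by rewrite addr_gt0// divr_gt0// expR_gt0.
rewrite -Rintegral_hexp_half//; apply: eq_Rintegral => p _.
have -> : a - 2^-1 + 1 - a = 2^-1 by lra.
congr (_ * expR (- _)).
have -> : - ln x + u + v + p = p + (u + v - ln x) by ring.
by rewrite expRD (expRB (u + v)) lnK// [1 + _]addrC addrK.
Qed.

End mellin_barnes.

(** * The product of two variance-gamma variables *)

Section density.
Context {R : realType} d {T : measurableType d}.
Variables (nu : {finite_measure set T -> \bar R}) (mu : {sigma_finite_measure set T -> \bar R}).

(** [f] and the Radon-Nikodym derivative have equal integrals over every measurable set, so they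
    agree almost everywhere. *)
Lemma ge0_integral_density (f : T -> R) : measurable_fun setT f ->
  (forall A, measurable A -> nu A = \int[mu]_(x in A) (f x)%:E)%E ->
  forall g : T -> \bar R, measurable_fun setT g -> (forall x, 0 <= g x)%E ->
  (\int[nu]_x g x = \int[mu]_x (g x * (f x)%:E))%E.
Proof.
move=> mf nuE g mg g0.
have numu : nu `<< mu.
  apply/null_content_dominatesP => A mA muA; rewrite nuE//.
  by rewrite null_set_integral//; exact/measurable_EFinP/measurable_funTS.
rewrite -(Radon_Nikodym_SigmaFinite.change_of_variables numu)//.
have mRN : measurable_fun setT (Radon_Nikodym_SigmaFinite.f nu mu).
  by apply: measurable_int; exact: Radon_Nikodym_SigmaFinite.f_integrable.
apply: ae_eq_integral => //.
- exact: emeasurable_funM.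
- by apply: emeasurable_funM => //; exact/measurable_EFinP.
apply: ae_eqe_mul2l; apply: integral_ae_eq => //.
- exact: Radon_Nikodym_SigmaFinite.f_integrable.
- exact/measurable_EFinP.
- by move=> E _ mE; rewrite -Radon_Nikodym_SigmaFinite.f_integral// nuE.
Qed.

End density.

Section joint_law.
Context d {T : measurableType d} {R : realType} (P : probability T R).

(** Independence says that the joint law and the product of the marginals agree on rectangles, which
    determine the product measure; Tonelli does the rest. *)
Lemma indep2_integral (X Y : {RV P >-> R}) : indep2 P X Y ->
  forall k : R * R -> \bar R, measurable_fun setT k -> (forall z, 0 <= k z)%E ->
  (\int[P]_w k (X w, Y w) =
   \int[distribution P X]_x \int[distribution P Y]_y k (x, y))%E.
Proof.
move=> XY k mk k0.
have mXY : measurable_fun setT (fun w => (X w, Y w)) by exact: measurable_fun_pair.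
rewrite -(fubini_tonelli1 k)//.
transitivity (\int[pushforward P (fun w => (X w, Y w))]_z k z)%E.
  by rewrite ge0_integral_pushforward.
apply: eq_measure_integral => A mA _; apply/esym.
apply: (@product_measure_unique _ _ _ _ _ (distribution P X) (distribution P Y)
  (pushforward P (fun w => (X w, Y w)))) => //.
Qed.

End joint_law.

(** * Variance-gamma laws as Gaussian mixtures *)

Section variance_gamma.
Context {R : realType}.
Notation mu := (@lebesgue_measure R).

(* Given the mixing variable [expR a], the variance-gamma variable is Gaussian
   with density proportional to [expR (- (vg_rate alpha a * x ^+ 2))]. *)
Definition vg_rate (alpha a : R) := alpha ^+ 2 / 4 * expR (- a).

Lemma vg_rate_gt0 alpha a : 0 < alpha -> 0 < vg_rate alpha a.
Proof. by move=> a0; rewrite mulr_gt0 ?expR_gt0// divr_gt0// exprn_gt0. Qed.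

(** The second double exponential controls the left tail, so [k] may have any sign; this matters for
    [-1/2 < m <= 0]. Each tail is [expR_quad_bound], the left one after [a -> - a]. *)
Lemma integrable_hexp2 (k c : R) : 0 < c ->
  mu.-integrable setT (fun a => (hexp k a * expR (- (c * expR (- a))))%:E).
Proof.
move=> c0.
have ch := @continuous_hexp R k.
apply: (@integrable_quad_decay R (fun a => hexp k a * expR (- (c * expR (- a))))).
  by apply: measurable_continuous; cont.
apply: (@quad_decay_eq _ (fun a => expR (k * a - expR a - c * expR (- a)))).
  by move=> a; rewrite -expRD.
apply: (@quad_decay_expR _ _ ((k + 1) ^+ 2 + (- k + 1) ^+ 2 / c) 1) => // a.
have p1 := sqr_ge0 (k + 1).
have p2 : 0 <= (- k + 1) ^+ 2 / c by rewrite divr_ge0 ?sqr_ge0// ltW.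
have e1 := expR_ge0 a; have e2 := mulr_ge0 (ltW c0) (expR_ge0 (- a)).
have [a0|a0] := lerP 0 a.
  have := expR_quad_bound k ltr01 a0; rewrite ger0_norm// divr1 !mul1r; lra.
have na0 : 0 <= - a by rewrite oppr_ge0 ltW.
have := expR_quad_bound (- k) c0 na0; rewrite ltr0_norm// mul1r mulrNN; lra.
Qed.

(** After unfolding to the whole line, [u = a - ln (z / 2)] turns [z cosh u] into
    [e^a + (z^2 / 4) e^(- a)]. *)
Lemma BesselK_hexp (nu z : R) : 0 < z ->
  BesselK nu z = 2^-1 * expR (- (nu * ln (z / 2))) *
    \int[mu]_a (hexp nu a * expR (- (z ^+ 2 / 4 * expR (- a)))).
Proof.
move=> z0; have z2 : 0 < z / 2 by rewrite divr_gt0.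
have zz : 0 < z ^+ 2 / 4 by rewrite divr_gt0// exprn_gt0.
rewrite -RintegralZl//; last exact: integrable_hexp2.
pose G u := 2^-1 * (expR (- (z * coshR u)) * expR (nu * u)).
have cG : continuous G by rewrite /G /coshR; cont.
have G0 u : 0 <= G u by rewrite /G !mulr_ge0 ?expR_ge0// invr_ge0.
transitivity (fine (\int[mu]_u (G u)%:E)%E).
  rewrite ge0_integralT_fold// /BesselK /Rintegral; congr fine.
  apply: eq_integral => u _; congr EFin; rewrite /G /coshR opprK mulrN (addrC (expR (- u))).
  by field.
rewrite /Rintegral; congr fine.
rewrite (ge0_integralT_affine (- ln (z / 2)) ltr01 cG G0) mul1e.
apply: eq_integral => a _; congr EFin; rewrite /G mul1r -[RHS]mulrA; congr (_ * _).
rewrite /hexp -!expRD; congr expR; rewrite /coshR expRB opprB (expRB (ln _)) lnK//.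
by rewrite expRN; field; rewrite !gt_eqF// expR_gt0.
Qed.

Definition vg_cst (m alpha : R) := alpha / (2 * Num.sqrt pi * GammaR (m + 2^-1)).

(* For [m <= 0] the integral diverges at [x = 0]. *)
Lemma vg_pdf_hexp (m alpha x : R) : - 2^-1 < m -> 0 < alpha -> x != 0 ->
  vg_pdf m alpha 0 x = \int[mu]_a
    (vg_cst m alpha * hexp m a * expR (- (vg_rate alpha a * x ^+ 2))).
Proof.
move=> hm a0 x0; have nx0 : 0 < `|x| by rewrite normr_gt0.
have z0 : 0 < alpha * `|x| by rewrite mulr_gt0.
have c0 : 0 < (alpha * `|x|) ^+ 2 / 4 by rewrite divr_gt0// exprn_gt0.
transitivity (vg_cst m alpha * \int[mu]_a
    (hexp m a * expR (- ((alpha * `|x|) ^+ 2 / 4 * expR (- a))))); last first.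
  rewrite -RintegralZl//; last exact: integrable_hexp2.
  apply: eq_Rintegral => a _; rewrite mulrA; congr (_ * expR (- _)).
  by rewrite /vg_rate exprMn real_normK ?num_real//; field.
rewrite /vg_pdf BesselK_hexp//; move: (\int[mu]_a _) => I.
rewrite mul0r expR0 mulr1 expr0n/= subr0 /vg_cst.
have pE (y r : R) : 0 < y -> y `^ r = expR (r * ln y) by move=> y0; rewrite -powR_expR lnK.
have G0 : 0 < GammaR (m + 2^-1) by apply: GammaR_gt0; rewrite -ltrBlDr sub0r.
have p0 : 0 < Num.sqrt (pi : R) by rewrite sqrtr_gt0 pi_gt0.
have ta0 : 0 < 2 * alpha by rewrite mulr_gt0.
rewrite !pE ?exprn_gt0//.
(* The powers collapse: [alpha^(2 m + 1) |x|^m (alpha |x| / 2)^(- m) = alpha (2 alpha)^m]. *)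
have K : expR ((m + 2^-1) * ln (alpha ^+ 2)) * expR (m * ln `|x|) *
    expR (- (m * ln (alpha * `|x| / 2))) = alpha * expR (m * ln (2 * alpha)).
  rewrite -!expRD -{3}(lnK (a0 : alpha \in Num.pos)) -expRD; congr expR.
  rewrite expr2 !lnM ?posrE ?invr_gt0// lnV ?posrE//.
  by field.
have s0 := expR_gt0 (m * ln (2 * alpha)); move: s0 K.
move: (expR (m * ln (2 * alpha))) (expR ((m + _) * _)) (expR (m * ln `|x|)) (expR (- _)).
move: (Num.sqrt pi) p0 (GammaR _) G0 => w w0 g g0 s p q r s0 K.
transitivity ((p * q * r) / s * (I / (2 * w * g))); first by field; rewrite !gt_eqF.
by rewrite K; field; rewrite !gt_eqF.
Qed.

End variance_gamma.

Section vg_product.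
Context {R : realType}.
Notation mu := (@lebesgue_measure R).

(** The origin is Lebesgue null, and the mixture formula for [vg_pdf] is available only off it. *)
Lemma eq_integral_neq0 (A : set R) (f g : R -> \bar R) : measurable A ->
  measurable_fun setT g -> (forall x, x != 0 -> f x = g x) ->
  (\int[mu]_(x in A) f x = \int[mu]_(x in A) g x)%E.
Proof.
move=> mA mg fg.
have mA0 : measurable (A `\ (0 : R)) by exact: measurableD.
have fgA : {in A `\ (0 : R), f =1 g} by move=> x /[!inE] -[_ /eqP]; exact: fg.
rewrite -(integral_setD1 (r := 0) (f := f))//; last first.
  apply: (eq_measurable_fun g); first by move=> x xA; rewrite fgA.
  exact: measurable_funTS.
rewrite -(integral_setD1 (r := 0) (f := g))//; last exact: measurable_funTS.
exact: eq_integral.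
Qed.

Lemma vg_cst_ge0 (m alpha : R) : - 2^-1 < m -> 0 < alpha -> 0 <= vg_cst m alpha.
Proof.
move=> hm a0; rewrite /vg_cst divr_ge0 ?(ltW a0)// mulr_ge0 ?mulr_ge0 ?sqrtr_ge0//.
by apply/ltW/GammaR_gt0; rewrite -ltrBlDr sub0r.
Qed.

Lemma vg_integral d (T : measurableType d) (P : probability T R) (X : {RV P >-> R})
    (m alpha : R) : - 2^-1 < m -> 0 < alpha -> has_pdf P X (vg_pdf m alpha 0) ->
  forall g : R -> \bar R, measurable_fun setT g -> (forall x, 0 <= g x)%E ->
  (\int[distribution P X]_x g x = \int[mu]_a ((vg_cst m alpha * hexp m a)%:E *
     \int[mu]_x (g x * (expR (- (vg_rate alpha a * x ^+ 2)))%:E)))%E.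
Proof.
move=> hm a0 [_ pX] g mg g0.
pose q x a := vg_cst m alpha * hexp m a * expR (- (vg_rate alpha a * x ^+ 2)).
have C0 := vg_cst_ge0 hm a0.
have q0 x a : 0 <= q x a by rewrite /q mulr_ge0 ?expR_ge0// mulr_ge0 ?hexp_ge0.
have mh := @measurable_hexp R m.
have mq : measurable_fun setT (fun z : R * R => (q z.1 z.2)%:E) by rewrite /q /vg_rate; meas.
have mrho : measurable_fun setT (fun x => \int[mu]_a (q x a)%:E)%E.
  apply: (@measurable_fun_fubini_tonelli_F _ _ _ _ _ mu (fun z : R * R => (q z.1 z.2)%:E)) => //.
  by move=> z; rewrite lee_fin.
(* For [m <= 0] the extended integral at [x = 0] is infinite while [r 0] is 0, so the two are
   compared off the origin. *)
pose r x := \int[mu]_a q x a.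
have mr : measurable_fun setT r by exact: measurableT_comp mrho.
have rE x : x != 0 -> ((r x)%:E = \int[mu]_a (q x a)%:E)%E.
  move=> x0; have c0 : 0 < alpha ^+ 2 / 4 * x ^+ 2.
    by rewrite mulr_gt0//; [rewrite divr_gt0 ?exprn_gt0|rewrite exprn_even_gt0].
  rewrite fineK//; apply: integrable_fin_num => //.
  apply: eq_integrable (integrableZl measurableT (vg_cst m alpha) (integrable_hexp2 m c0)) => // a _.
  rewrite /= -EFinM /q /vg_rate mulrA; congr EFin; congr (_ * expR (- _)); ring.
have nuE A : measurable A -> (distribution P X A = \int[mu]_(x in A) (r x)%:E)%E.
  move=> mA; rewrite /distribution /pushforward pX//.
  apply: eq_integral_neq0 => //; first exact/measurable_EFinP.
  by move=> x x0; rewrite vg_pdf_hexp.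
(* [X1] is [X] with values in [measurableTypeR R], so that its law and Lebesgue measure live on one
   type when the density lemma is applied. *)
have mX0 : measurable_fun setT X by exact: measurable_funPT.
have mX1 : measurable_fun setT (X : T -> measurableTypeR R) by move=> mT B mB; exact: mX0.
have mixX1 := isMeasurableFun.Build _ _ _ _ (X : T -> measurableTypeR R) mX1.
pose X1 : {RV P >-> measurableTypeR R} := HB.pack (X : T -> measurableTypeR R) mixX1.
rewrite ge0_integral_distribution// -(@ge0_integral_distribution _ _ _ _ _ P X1 g mg g0).
rewrite (@ge0_integral_density R _ (measurableTypeR R) (distribution P X1) mu r mr nuE g mg g0).
transitivity (\int[mu]_x (g x * \int[mu]_a (q x a)%:E))%E.
  apply: eq_integral_neq0 => //; first exact: emeasurable_funM.
  by move=> x x0; rewrite rE.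
have mqx x : measurable_fun setT (fun a => (q x a)%:E) by rewrite /q /vg_rate; meas.
transitivity (\int[mu]_x \int[mu]_a (g x * (q x a)%:E))%E.
  apply: eq_integral => x _; rewrite ge0_integralZl//.
    exact: (mqx x).
  by move=> a _; rewrite lee_fin.
transitivity (\int[mu]_a \int[mu]_x (g x * (q x a)%:E))%E.
  apply: (@fubini_tonelli _ _ _ _ _ mu mu (fun z => g z.1 * (q z.1 z.2)%:E)%E).
    by apply: emeasurable_funM => //; apply: measurableT_comp mg _.
  by move=> z; rewrite mule_ge0// lee_fin.
apply: eq_integral => a _; rewrite -ge0_integralZl//.
- by apply: eq_integral => x _; rewrite /q EFinM muleCA.
- apply: emeasurable_funM => //; by meas.
- by move=> x _; rewrite mule_ge0// lee_fin expR_ge0.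
- by rewrite lee_fin mulr_ge0// hexp_ge0.
Qed.

(** The Gaussian mass [sqrt (pi / rate)] is proportional to [e^(a / 2)], which shifts [m] to
    [m + 1/2]; the result is the density of the logarithm of a Gamma variable. *)
Lemma vg_cst_hexp (m alpha a : R) : 0 < alpha ->
  vg_cst m alpha * hexp m a * Num.sqrt (pi / vg_rate alpha a) =
  (GammaR (m + 2^-1))^-1 * hexp (m + 2^-1) a.
Proof.
move=> a0; rewrite /vg_cst /vg_rate.
have e : expR (- a) = expR (- (2^-1 * a)) ^+ 2 by rewrite -expRM_natl; congr expR; field.
have -> : alpha ^+ 2 / 4 * expR (- a) = (alpha / 2 * expR (- (2^-1 * a))) ^+ 2.
  by rewrite e; field.
have b0 : 0 < alpha / 2 * expR (- (2^-1 * a)) by rewrite mulr_gt0 ?divr_gt0 ?expR_gt0.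
rewrite sqrtrM ?pi_ge0// sqrtrV ?sqr_ge0// sqrtr_sqr ger0_norm ?(ltW b0)//.
rewrite hexpD !invfM expRN invrK invrK.
have p0 : Num.sqrt (pi : R) != 0 by rewrite gt_eqF// sqrtr_gt0 pi_gt0.
move: (GammaR _)^-1 => g; field.
by rewrite p0 gt_eqF.
Qed.

Lemma integral_gauss2 (l k c : R) : 0 < l -> 0 <= k ->
  (\int[mu]_x ((1 + c * expR (- (k * x ^+ 2))) * expR (- (l * x ^+ 2)))%:E =
   (Num.sqrt (pi / l) + c * Num.sqrt (pi / (l + k)))%:E)%E.
Proof.
move=> l0 k0; have lk0 : 0 < l + k by rewrite ltr_pwDl.
have i1 := integrable_gauss l0; have i2 := integrable_gauss lk0.
rewrite -!Rintegral_gauss// -RintegralZl// -RintegralD//; last first.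
  exact: (integrableZl measurableT c i2).
rewrite fineK.
  apply: eq_integral => x _; congr EFin; rewrite mulrDl mul1r -mulrA -expRD.
  by congr (_ + _ * expR _); ring.
apply: integrable_fin_num => //.
exact: (integrableD measurableT i1 (integrableZl measurableT c i2)).
Qed.

Section product.
Context d (T : measurableType d) (P : probability T R) (X Y : {RV P >-> R}).
Variables (m n alpha1 alpha2 t : R).
Hypotheses (hm : - 2^-1 < m) (hn : - 2^-1 < n) (a1 : 0 < alpha1) (a2 : 0 < alpha2).
Hypotheses (pX : has_pdf P X (vg_pdf m alpha1 0)) (pY : has_pdf P Y (vg_pdf n alpha2 0)).
Hypotheses (XY : indep2 P X Y) (t0 : t != 0).

Let x := alpha1 ^+ 2 * alpha2 ^+ 2 / (4 * t ^+ 2).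
Let s y := (Num.sqrt (1 + expR y / x))^-1.
(** [kappa v * y^2] is the exponent [(t y)^2 / (4 l)] of the Gaussian transform for
    [l = vg_rate alpha2 v]. *)
Let kappa v := t ^+ 2 / alpha2 ^+ 2 * expR v.
Let Gm := GammaR (m + 2^-1).
Let Gn := GammaR (n + 2^-1).

Let x_gt0 : 0 < x.
Proof.
rewrite /x divr_gt0//; first by rewrite mulr_gt0 ?exprn_gt0.
by rewrite mulr_gt0 ?exprn_even_gt0.
Qed.

Let kappa_ge0 v : 0 <= kappa v.
Proof. by rewrite /kappa mulr_ge0 ?expR_ge0// divr_ge0 ?sqr_ge0. Qed.

Let den_gt1 y : 1 < 1 + expR y / x.
Proof. by rewrite ltrDl divr_gt0// expR_gt0. Qed.

Let s_ge0 y : 0 <= s y.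
Proof. by rewrite invr_ge0 sqrtr_ge0. Qed.

Let s_le1 y : s y <= 1.
Proof.
rewrite /s invf_le1 ?sqrtr_gt0 ?(lt_trans ltr01)//.
by rewrite -{1}sqrtr1 ler_sqrt ltW// (lt_trans ltr01).
Qed.

Let measurable_s : measurable_fun setT s.
Proof.
apply: measurable_continuous => y; rewrite /s.
apply: (@continuousV _ _ (fun y => Num.sqrt (1 + expR y / x))).
  by rewrite gt_eqF// sqrtr_gt0 (lt_trans ltr01).
apply: (@continuous_comp _ _ _ (fun y => 1 + expR y / x) Num.sqrt); first by cont.
exact: sqrt_continuous.
Qed.

Let Gm_gt0 : 0 < Gm. Proof. by apply: GammaR_gt0; rewrite -ltrBlDr sub0r. Qed.
Let Gn_gt0 : 0 < Gn. Proof. by apply: GammaR_gt0; rewrite -ltrBlDr sub0r. Qed.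

(** [Y] is integrated out for a fixed value [y] of [X]: given its mixing variable, this is the
    Gaussian transform at frequency [t y]. *)
Let inner b y : (\int[distribution P Y]_z (1 + trig b (t * (y * z)))%:E =
  \int[mu]_v (Gn^-1 * hexp (n + 2^-1) v * (1 + b%:R * expR (- (kappa v * y ^+ 2))))%:E)%E.
Proof.
have mt := @measurable_continuous _ setT _ (@continuous_trig R b).
rewrite (vg_integral hn a2 pY).
- apply: eq_integral => v _.
  have l0 := vg_rate_gt0 v a2.
  under eq_integral do rewrite mulrA -EFinM.
  rewrite integral_gauss_trig// -EFinM mulrA vg_cst_hexp//; congr (_ * (1 + _ * expR (- _)))%:E.
  by rewrite /kappa /vg_rate expRN; field; rewrite !gt_eqF// expR_gt0.
- by meas.
- by move=> z; rewrite lee_fin trig_ge0.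
Qed.

Let weight_ge0 b v y : 0 <= Gn^-1 * hexp (n + 2^-1) v * (1 + b%:R * expR (- (kappa v * y ^+ 2))).
Proof.
rewrite !mulr_ge0 ?hexp_ge0 ?invr_ge0 ?(ltW Gn_gt0)// addr_ge0// mulr_ge0 ?expR_ge0//.
Qed.

Lemma integral_vg_product (b : bool) :
  (\int[P]_w (1 + trig b (t * (X w * Y w)))%:E = ((Gm * Gn)^-1)%:E *
    \int[mu]_u ((hexp (m + 2^-1) u)%:E *
      \int[mu]_v (hexp (n + 2^-1) v * (1 + b%:R * s (u + v)))%:E))%E.
Proof.
have mt := @measurable_continuous _ setT _ (@continuous_trig R b).
rewrite (indep2_integral XY (k := fun z => (1 + trig b (t * (z.1 * z.2)))%:E)); last 2 first.
- by meas.
- by move=> z; rewrite lee_fin trig_ge0.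
under eq_integral do rewrite /= inner.
pose w v y := Gn^-1 * hexp (n + 2^-1) v * (1 + b%:R * expR (- (kappa v * y ^+ 2))).
have mh := @measurable_hexp R (n + 2^-1); have mh' := @measurable_hexp R (m + 2^-1).
have mw : measurable_fun setT (fun z : R * R => (w z.2 z.1)%:E).
  by rewrite /w /kappa; meas.
have w0 v y : (0 <= (w v y)%:E)%E by rewrite lee_fin weight_ge0.
rewrite (vg_integral hm a1 pX (g := fun y => \int[mu]_v (w v y)%:E)%E); last 2 first.
- exact: (measurable_fun_fubini_tonelli_F (m2 := mu) (fun z : R * R => (w z.2 z.1)%:E)).
- by move=> y; exact: integral_ge0.
have hs0 u v : 0 <= hexp (n + 2^-1) v * (1 + b%:R * s (u + v)).
  by rewrite mulr_ge0 ?hexp_ge0// addr_ge0// mulr_ge0.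
have mhs : measurable_fun setT
    (fun z : R * R => (hexp (n + 2^-1) z.2 * (1 + b%:R * s (z.1 + z.2)))%:E) by meas.
rewrite -ge0_integralZl//; last 3 first.
- apply: emeasurable_funM; first exact/measurable_EFinP.
  apply: (measurable_fun_fubini_tonelli_F (m2 := mu)
    (fun z : R * R => (hexp (n + 2^-1) z.2 * (1 + b%:R * s (z.1 + z.2)))%:E)) => // z.
  by rewrite lee_fin.
- by move=> u _; rewrite mule_ge0 ?lee_fin ?hexp_ge0//; apply: integral_ge0 => v _; rewrite lee_fin.
- by rewrite lee_fin invr_ge0 ltW// mulr_gt0.
apply: eq_integral => u _.
have l0 := vg_rate_gt0 u a1.
set l := vg_rate alpha1 u in l0 *.
pose e y := expR (- (l * y ^+ 2)).
have me : measurable_fun setT e by rewrite /e; meas.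
have sE v : Num.sqrt (pi / (l + kappa v)) = Num.sqrt (pi / l) * s (u + v).
  (* The origin of the Meijer argument: [kappa v / l = 4 t^2 e^(u + v) / (alpha1^2 alpha2^2)]. *)
  have -> : l + kappa v = l * (1 + expR (u + v) / x).
    rewrite /l /vg_rate /kappa /x expRD expRN; field.
    by rewrite t0 !gt_eqF// expR_gt0.
  rewrite invfM mulrA sqrtrM; last by rewrite divr_ge0 ?pi_ge0// ltW.
  by rewrite sqrtrV// ltW// (lt_trans ltr01).
have -> : (\int[mu]_y (\int[mu]_v (w v y)%:E * (e y)%:E) =
    (Gn^-1 * Num.sqrt (pi / l))%:E * \int[mu]_v (hexp (n + 2^-1) v * (1 + b%:R * s (u + v)))%:E)%E.
  transitivity (\int[mu]_y \int[mu]_v (w v y * e y)%:E)%E.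
    apply: eq_integral => y _; rewrite -ge0_integralZr//.
    - by rewrite /w /kappa; meas.
    - by rewrite lee_fin expR_ge0.
  transitivity (\int[mu]_v \int[mu]_y (w v y * e y)%:E)%E.
    apply: (@fubini_tonelli _ _ _ _ _ mu mu (fun z => (w z.2 z.1 * e z.1)%:E)).
      by apply/measurable_EFinP; apply: measurable_funM; [exact/measurable_EFinP|meas].
    by move=> z; rewrite EFinM mule_ge0// lee_fin expR_ge0.
  rewrite -ge0_integralZl//; last 3 first.
  - by meas.
  - by move=> v _; rewrite lee_fin.
  - by rewrite lee_fin mulr_ge0 ?invr_ge0 ?sqrtr_ge0 ?(ltW Gn_gt0).
  apply: eq_integral => v _; rewrite /w /e.
  under eq_integral do rewrite -mulrA EFinM.
  rewrite ge0_integralZl//.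
  - rewrite integral_gauss2// -EFinM sE -EFinM; congr EFin; ring.
  - by rewrite /kappa; meas.
  - by rewrite lee_fin mulr_ge0 ?hexp_ge0// invr_ge0 ltW.
rewrite !muleA -!EFinM; congr (_%:E * _)%E.
by rewrite mulrCA -/l vg_cst_hexp// invfM; ring.
Qed.

(** Removal of the auxiliary 1 from both sides. Subtraction needs finite integrals, which [s <= 1]
    provides by comparison with Gamma integrals. *)
Lemma Rintegral_vg_product (b : bool) :
  \int[P]_w trig b (t * (X w * Y w)) = b%:R / (Num.sqrt pi * Gm * Gn) *
    \int[mu]_u (hexp (m + 2^-1) u * \int[mu]_v (hexp (n + 2^-1) v *
      Num.sqrt (pi / (1 + expR (u + v) / x)))).
Proof.
have mt := @measurable_continuous _ setT _ (@continuous_trig R b).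
have mh := @measurable_hexp R (n + 2^-1); have mh' := @measurable_hexp R (m + 2^-1).
have hm0 : 0 < m + 2^-1 by rewrite -ltrBlDr sub0r.
have hn0 : 0 < n + 2^-1 by rewrite -ltrBlDr sub0r.
have ihm := integrable_hexp hm0; have ihn := integrable_hexp hn0.
pose S u := \int[mu]_v (hexp (n + 2^-1) v * s (u + v)).
have iS u : mu.-integrable setT (fun v => (hexp (n + 2^-1) v * s (u + v))%:E).
  apply: (le_integrable measurableT _ _ ihn); first by meas.
  by move=> v _ /=; rewrite lee_fin normrM ler_piMr// ger0_norm.
have S0 u : 0 <= S u by apply: Rintegral_ge0 => v _; rewrite mulr_ge0 ?hexp_ge0.
have SG u : S u <= Gn.
  rewrite /Gn GammaR_hexp; apply: le_Rintegral => //; first exact: iS.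
  move=> v _.
  by rewrite ler_piMr ?hexp_ge0.
have mS : measurable_fun setT S.
  apply: measurableT_comp => //.
  apply: (measurable_fun_fubini_tonelli_F (m2 := mu)
    (fun z : R * R => (hexp (n + 2^-1) z.2 * s (z.1 + z.2))%:E)); first by meas.
  by move=> z; rewrite lee_fin mulr_ge0 ?hexp_ge0.
have iJ : mu.-integrable setT (fun u => (hexp (m + 2^-1) u * S u)%:E).
  apply: (@le_integrable _ _ _ mu setT measurableT _ (fun u => Gn%:E * (hexp (m + 2^-1) u)%:E)%E).
  - by meas.
  - move=> u _ /=; rewrite lee_fin !normrM mulrC ler_wpM2r//.
    by rewrite !ger0_norm// ltW.
  - exact: integrableZl.
have innerE u : (\int[mu]_v (hexp (n + 2^-1) v * (1 + b%:R * s (u + v)))%:E = (Gn + b%:R * S u)%:E)%E.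
  rewrite /S /Gn GammaR_hexp -RintegralZl//; last exact: iS.
  rewrite -RintegralD//; last exact: (integrableZl measurableT b%:R (iS u)).
  rewrite fineK.
    by apply: eq_integral => v _; congr EFin; ring.
  apply: integrable_fin_num => //.
  exact: (integrableD measurableT ihn (integrableZl measurableT b%:R (iS u))).
(* The constant part integrates to [Gm * Gn], which after normalization is the 1 to be
   subtracted. *)
have outerE : (\int[mu]_u ((hexp (m + 2^-1) u)%:E * (Gn + b%:R * S u)%:E) =
    (Gm * Gn + b%:R * \int[mu]_u (hexp (m + 2^-1) u * S u))%:E)%E.
  rewrite /Gm GammaR_hexp -(RintegralZl b%:R measurableT iJ) -(RintegralZr Gn measurableT ihm) -RintegralD//; last 2 first.
  - exact: (integrableZr measurableT Gn ihm).
  - exact: (integrableZl measurableT b%:R iJ).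
  rewrite fineK.
    by apply: eq_integral => u _; rewrite -EFinM; congr EFin; ring.
  apply: integrable_fin_num => //.
  exact: (integrableD measurableT (integrableZr measurableT Gn ihm) (integrableZl measurableT b%:R iJ)).
have mZ : measurable_fun setT (fun w => trig b (t * (X w * Y w))) by meas.
have iT : P.-integrable setT (fun w => (trig b (t * (X w * Y w)))%:E).
  apply: (@le_integrable _ _ _ P setT measurableT _ (cst 1%E)); first exact/measurable_EFinP.
    by move=> w _ /=; rewrite lee_fin normr1 trig_le1.
  exact: finite_measure_integrable_cst.
have := integral_vg_product b.
under [in RHS]eq_integral do rewrite innerE.
rewrite outerE -EFinM => E.
have -> : \int[P]_w trig b (t * (X w * Y w)) = \int[P]_w (1 + trig b (t * (X w * Y w))) - 1.
  rewrite RintegralD//; last exact: finite_measure_integrable_cst.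
  have -> : \int[P]_w (1 : R) = 1.
    rewrite /Rintegral integral_cst// mul1e.
    exact: (congr1 fine (probability_setT P)).
  by rewrite addrAC subrr add0r.
have -> : \int[mu]_u (hexp (m + 2^-1) u * \int[mu]_v (hexp (n + 2^-1) v *
      Num.sqrt (pi / (1 + expR (u + v) / x)))) =
    Num.sqrt pi * \int[mu]_u (hexp (m + 2^-1) u * S u).
  rewrite -RintegralZl//; apply: eq_Rintegral => u _.
  rewrite mulrCA; congr (_ * _); rewrite /S -RintegralZl//; last exact: iS.
  apply: eq_Rintegral => v _; rewrite mulrCA; congr (_ * _).
  by rewrite sqrtrM ?pi_ge0// sqrtrV// ltW// (lt_trans ltr01).
rewrite {1}/Rintegral E /=; field.
by rewrite !gt_eqF// sqrtr_gt0 pi_gt0.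
Qed.

End product.

End vg_product.

Theorem mainTheorem6 (R : realType) (d : measure_display) (T : measurableType d)
    (P : probability T R) (X Y : T -> R) (m n alpha1 alpha2 : R) :
  - 2^-1 < m -> - 2^-1 < n -> 0 < alpha1 -> 0 < alpha2 ->
  has_pdf P X (vg_pdf m alpha1 0) ->
  has_pdf P Y (vg_pdf n alpha2 0) ->
  indep2 P X Y ->
  forall t : R, t != 0 ->
    let Z := fun w => X w * Y w in
    let x := alpha1 ^+ 2 * alpha2 ^+ 2 / (4 * t ^+ 2) in
    charfun P Z t
      = ((alpha1 * alpha2
           / (2 * Num.sqrt pi * GammaR (m + 2^-1) * GammaR (n + 2^-1))
          * `|t|^-1)%:C
         * MeijerG31_13 x (2^-1) 0 m n)%C
    /\ charfun P Z t
      = ((Num.sqrt pi * GammaR (m + 2^-1) * GammaR (n + 2^-1))^-1%:C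
         * MeijerG31_13 x 1 (2^-1) (m + 2^-1) (n + 2^-1))%C.
Proof.
move=> hm hn a1 a2 pX pY XY t t0 Z x.
have x0 : 0 < x.
  rewrite /x divr_gt0//; first by rewrite mulr_gt0 ?exprn_gt0.
  by rewrite mulr_gt0 ?exprn_even_gt0.
have mixX := isMeasurableFun.Build _ _ _ _ X pX.1.
have mixY := isMeasurableFun.Build _ _ _ _ Y pY.1.
pose X' : {RV P >-> R} := HB.pack X mixX.
pose Y' : {RV P >-> R} := HB.pack Y mixY.
have H := @Rintegral_vg_product R d T P X' Y' m n alpha1 alpha2 t hm hn a1 a2 pX pY XY t0.
rewrite -/x in H.
have Gm0 : 0 < GammaR (m + 2^-1) by apply: GammaR_gt0; rewrite -ltrBlDr sub0r.
have Gn0 : 0 < GammaR (n + 2^-1) by apply: GammaR_gt0; rewrite -ltrBlDr sub0r.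
have p0 : 0 < Num.sqrt (pi : R) by rewrite sqrtr_gt0 pi_gt0.
set J := \int[_]_u _ in H.
have -> : charfun P Z t =
    (J / (Num.sqrt pi * GammaR (m + 2^-1) * GammaR (n + 2^-1)))%:C%C.
  rewrite /charfun; have := H true; have := H false; rewrite /trig => -> ->.
  by rewrite !mul0r mul1r mulrC.
(* Both G-functions belong to this family, at [a = 1/2] and [a = 1]: a common shift of all
   parameters changes only the power of [x]. *)
have M a : MeijerG31_13 x a (a - 2^-1) (m + a - 2^-1) (n + a - 2^-1) =
    (x `^ (a - 1) * J)%:C%C.
  have h1 : a - 1 < m + a - 2^-1 by lra.
  have h2 : a - 1 < n + a - 2^-1 by lra.
  rewrite (MeijerG31_13_half x0 h1 h2).
  have e1 : m + a - 2^-1 + 1 - a = m + 2^-1 by field.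
  have e2 : n + a - 2^-1 + 1 - a = n + 2^-1 by field.
  rewrite e1 e2; reflexivity.
split.
- have := M 2^-1; rewrite subrr !addrK => ->; rewrite -rmorphM /=; congr (_)%:C%C.
  (* This power of [x] cancels the factor [alpha1 alpha2 / (2 |t|)] of the first formula. *)
  have -> : x `^ (2^-1 - 1) = (alpha1 * alpha2 / (2 * `|t|))^-1.
    have -> : 2^-1 - 1 = - 2^-1 :> R by field.
    rewrite powRN powR12_sqrt ?(ltW x0)//; congr (_^-1).
    have -> : x = (alpha1 * alpha2 / (2 * `|t|)) ^+ 2.
      by rewrite /x exprMn exprVn !exprMn real_normK ?num_real//; congr (_ / _); ring.
    by rewrite sqrtr_sqr ger0_norm// divr_ge0 ?mulr_ge0// ltW.
  by field; rewrite !gt_eqF// normr_gt0.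
- have := M 1.
  have -> : 1 - 2^-1 = 2^-1 :> R by field.
  have -> : m + 1 - 2^-1 = m + 2^-1 by field.
  have -> : n + 1 - 2^-1 = n + 2^-1 by field.
  rewrite subrr powRr0 mul1r => ->; rewrite -rmorphM /=; congr (_)%:C%C.
  by rewrite mulrC.
Qed.
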